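(* For every distortion vector $\mathbf{D}=(D_1,\dots,D_m)$, the rate-distortion function satisfies $R(\mathbf{D})\le R_{ach}(\mathbf{D})$, where $R_{ach}(\mathbf{D})$ is the lower convex envelope (as a function of $\mathbf{D}$) of $$R'_{ach}(\mathbf{D})=\min_{v\in\mathcal{V}}\ \inf_{p\in C_{ach,v}(\mathbf{D})}\ \inf_{(R_{\mathcal{S}_j},R'_{\mathcal{S}_j})_j\in C^{LP}_{ach}(p)}\ \sum_{j=1}^{2^m-1}R_{\mathcal{S}_j}.$$ Here, for an ordering $v=(\mathcal{S}_1,\dots,\mathcal{S}_{2^m-1})$, $C_{ach,v}(\mathbf{D})$ is the set of joint distributions $p$ of $(U_{\mathcal{S}_1},\dots,U_{\mathcal{S}_{2^m-1}},X,Y_1,\dots,Y_m)$, where each $U_{\mathcal{S}_j}$ takes values in some finite alphabet, such that: (1) the marginal of $(X,Y_1,\dots,Y_m)$ under $p$ equals the given source/side-information distribution; (2) $\mathcal{U}\leftrightarrow X\leftrightarrow (Y_1,\dots,Y_m)$ is a Markov chain; (3) for every $l\in[m]$ there is a function $g_l$ with $E[d_l(X,g_l(U_{\mathcal{D}_l},Y_l))]\le D_l$. And $C^{LP}_{ach}(p)$ is the set of nonnegative reals $R_{\mathcal{S}_j},R'_{\mathcal{S}_j}$, $j\in[2^m-1]$, such that (i) $R_{\mathcal{S}_j}\ge I(X,U^-_{\mathcal{S}_j};U_{\mathcal{S}_j})-R'_{\mathcal{S}_j}$ for all $j$; and (ii) for every decoder $l\in[m]$ and every nonempty $\mathcal{D}'_l\subseteq\mathcal{D}_l$,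 $$\sum_{\mathcal{S}_j\in\mathcal{D}'_l}R'_{\mathcal{S}_j}\le \sum_{\mathcal{S}_j\in\mathcal{D}'_l}H(U_{\mathcal{S}_j})-H\big(U_{\mathcal{D}'_l}\,\big|\,U_{\mathcal{D}_l\setminus\mathcal{D}'_l},Y_l\big),$$ all information quantities being computed under $p$.
   Context: Setting (finite alphabets): a source $X$ on finite alphabet $\mathcal{X}$ and side informations $Y_1,\dots,Y_m$ on finite alphabets $\mathcal{Y}_l$, with a given joint distribution of $(X,Y_1,\dots,Y_m)$; the sequence $(X_k,Y_{1k},\dots,Y_{mk})_{k\ge1}$ is i.i.d. Reconstruction alphabets $\widehat{\mathcal{X}}_l$ are finite and $d_l:\mathcal{X}\times\widehat{\mathcal{X}}_l\to[0,\infty)$ are distortion measures. An $(n,M,\mathbf{D})$ code consists of an encoder $f:\mathcal{X}^n\to\{1,\dots,M\}$ and decoders $g_l:\{1,\dots,M\}\times\mathcal{Y}_l^n\to\widehat{\mathcal{X}}_l^n$, $l\in[m]$, such that with $\widehat{X}_l^n=g_l(f(X^n),Y_l^n)$ one has $E[\frac1n\sum_{k=1}^n d_l(X_k,\widehat{X}_{lk})]\le D_l$ for all $l$. A rate $R$ is $\mathbf{D}$-achievable if for every $\epsilon>0$ and all sufficiently large $n$ there is an $(n,M,\mathbf{D}+\epsilon\mathbf{1})$ code with $\frac1n\log M\le R+\epsilon$; $R(\mathbf{D})$ is the infimum of $\mathbf{D}$-achievable rates. Notation: $\mathcal{V}$ is the set of all orderings $v=(\mathcal{S}_1,\dots,\mathcal{S}_{2^m-1})$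 of the nonempty subsets of $[m]$. For a fixed $v$, there is one auxiliary random variable $U_{\mathcal{S}_j}$ per subset, and $\mathcal{U}=\{U_{\mathcal{S}_1},\dots,U_{\mathcal{S}_{2^m-1}}\}$. $\mathcal{D}_l=\{\mathcal{S}_i: l\in\mathcal{S}_i\}$; for $\mathcal{D}'_l\subseteq\mathcal{D}_l$, $U_{\mathcal{D}'_l}=\{U_{\mathcal{S}_i}:\mathcal{S}_i\in\mathcal{D}'_l\}$; $U^-_{\mathcal{S}_j}=\{U_{\mathcal{S}_i}: i<j\}$ (variables earlier in the order $v$). *)

(* Defs.v *)
From HB Require Import structures.
From mathcomp Require Import all_boot.
From Stdlib Require Import Reals.

Unset Implicit Arguments.
Unset Strict Implicit.
Unset Printing Implicit Defensive.

Local Open Scope R_scope.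

Section Info.
Context {Om : finType} (q : Om -> R).

Definition prob_of {T : eqType} (Z : Om -> T) (t : T) : R :=
  \big[Rplus/0]_(w : Om | Z w == t) q w.

Definition entropy {T : eqType} (Z : Om -> T) : R :=
  \big[Rplus/0]_(t <- undup [seq Z w | w <- enum Om])
     (- (prob_of Z t * ln (prob_of Z t))).

Definition centropy {T T' : eqType} (Z : Om -> T) (W : Om -> T') : R :=
  entropy (fun w => (Z w, W w)) - entropy W.

Definition minfo {T T' : eqType} (Z : Om -> T) (W : Om -> T') : R :=
  entropy Z + entropy W - entropy (fun w => (Z w, W w)).
End Info.

Section Setting.
Context (X : finType) (m : nat) (Y Xh : 'I_m -> finType)
        (P : X -> {dffun forall l : 'I_m, Y l} -> R)
        (d : forall l : 'I_m, X -> Xh l -> R).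

Definition Yv := {dffun forall l : 'I_m, Y l}.

Definition exp_dist (n M : nat) (f : {ffun 'I_n -> X} -> 'I_M)
  (g : forall l : 'I_m, 'I_M -> {ffun 'I_n -> Y l} -> {ffun 'I_n -> Xh l})
  (l : 'I_m) : R :=
  \big[Rplus/0]_(w : {ffun 'I_n -> (X * Yv)%type})
    ((\big[Rmult/1]_(k : 'I_n) P (w k).1 (w k).2) *
     (/ INR n * \big[Rplus/0]_(k : 'I_n)
        d l (w k).1 (g l (f [ffun k' => (w k').1]) [ffun k' => (w k').2 l] k))).

Definition is_code (n M : nat) (Dv : 'I_m -> R) : Prop :=
  exists (f : {ffun 'I_n -> X} -> 'I_M)
         (g : forall l : 'I_m, 'I_M -> {ffun 'I_n -> Y l} -> {ffun 'I_n -> Xh l}),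
    forall l, exp_dist n M f g l <= Dv l.

Definition achievable (D : 'I_m -> R) (r : R) : Prop :=
  forall eps, 0 < eps -> exists N : nat, forall n : nat, leq N n -> leq 1 n ->
    exists M : nat, is_code n M (fun l => D l + eps) /\ ln (INR M) / INR n <= r + eps.

(* "R(D) <= b", where R(D) is the infimum of the D-achievable rates *)
Definition RD_le (D : 'I_m -> R) (b : R) : Prop :=
  forall eps, 0 < eps -> exists r, achievable D r /\ r < b + eps.

Definition K := subn (expn 2 m) 1.

(* auxiliary alphabets U_{S_j} are 'I_(c j) *)
Definition Uv (c : 'I_K -> nat) := {dffun forall j : 'I_K, 'I_(c j)}.

Definition UA (c : 'I_K -> nat) (A : {set 'I_K}) (u : Uv c) : {ffun 'I_K -> option nat} :=
  [ffun j => if j \in A then Some (nat_of_ord (u j)) else None].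

Definition Dl (v : 'I_K -> {set 'I_m}) (l : 'I_m) : {set 'I_K} := [set j | l \in v j].

Definition Uminus (j : 'I_K) : {set 'I_K} := [set i : 'I_K | ltn i j].

Definition in_Cach (D : 'I_m -> R) (v : 'I_K -> {set 'I_m}) (c : 'I_K -> nat)
  (p : Uv c -> X -> Yv -> R) : Prop :=
  (forall u x y, 0 <= p u x y) /\
  (forall x y, \big[Rplus/0]_(u : Uv c) p u x y = P x y) /\
  (forall u x y,
     p u x y * (\big[Rplus/0]_(u' : Uv c) \big[Rplus/0]_(y' : Yv) p u' x y')
     = (\big[Rplus/0]_(y' : Yv) p u x y') * (\big[Rplus/0]_(u' : Uv c) p u' x y)) /\
  (forall l : 'I_m, exists g : Uv c -> Y l -> Xh l,
     (forall (u u' : Uv c) (y : Y l), (forall j, j \in Dl v l -> u j = u' j) -> g u y = g u' y) /\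
     \big[Rplus/0]_(u : Uv c) \big[Rplus/0]_(x : X) \big[Rplus/0]_(y : Yv)
        (p u x y * d l x (g u (y l))) <= D l).

Definition jointq (c : 'I_K -> nat) (p : Uv c -> X -> Yv -> R)
  (w : ((Uv c * X) * Yv)%type) : R := p w.1.1 w.1.2 w.2.

Definition in_CLP (v : 'I_K -> {set 'I_m}) (c : 'I_K -> nat)
  (p : Uv c -> X -> Yv -> R) (Rr Rp : 'I_K -> R) : Prop :=
  let q := jointq c p in
  (forall j, 0 <= Rr j /\ 0 <= Rp j) /\
  (forall j : 'I_K,
     Rr j >= minfo q (fun w => (w.1.2, UA c (Uminus j) w.1.1))
                     (fun w => w.1.1 j) - Rp j) /\
  (forall (l : 'I_m) (A : {set 'I_K}), A \subset Dl v l -> A != set0 ->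
     \big[Rplus/0]_(j in A) Rp j <=
     \big[Rplus/0]_(j in A) entropy q (fun w => w.1.1 j)
     - centropy q (fun w => UA c A w.1.1)
                  (fun w => (UA c (Dl v l :\: A) w.1.1, w.2 l))).

(* b is one of the values over which R'_ach(D) takes min/inf *)
Definition Rprime_val (D : 'I_m -> R) (b : R) : Prop :=
  exists v : 'I_K -> {set 'I_m},
    injective v /\ (forall j, v j != set0) /\
    exists (c : 'I_K -> nat) (p : Uv c -> X -> Yv -> R) (Rr Rp : 'I_K -> R),
      in_Cach D v c p /\ in_CLP v c p Rr Rp /\ b = \big[Rplus/0]_(j : 'I_K) Rr j.

(* b is one of the values over which the lower convex envelope R_ach(D)
   takes its infimum: b = sum_i lam_i a_i with a_i a value for R'_ach(D_i),
   D = sum_i lam_i D_i, (lam_i) a probability vector. *)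
Definition Rach_val (D : 'I_m -> R) (b : R) : Prop :=
  exists (k : nat) (lam : 'I_k -> R) (Ds : 'I_k -> 'I_m -> R) (a : 'I_k -> R),
    (forall i, 0 <= lam i) /\ \big[Rplus/0]_(i : 'I_k) lam i = 1 /\
    (forall l, \big[Rplus/0]_(i : 'I_k) (lam i * Ds i l) = D l) /\
    (forall i, Rprime_val (Ds i) (a i)) /\
    b = \big[Rplus/0]_(i : 'I_k) (lam i * a i).

End Setting.

(* Main.v *)
Require Import Defs.
From mathcomp Require Import all_boot.
From Stdlib Require Import Reals.
From HB Require Import structures.
From Stdlib Require Import ZArith Lra Lia ClassicalEpsilon.

(** Random coding with independent codebooks and binning. For each subset S_j
    draw about exp(n I(X,U^-_{S_j}; U_{S_j})) words i.i.d. from the marginal of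
    U_{S_j} and split them into bins of about exp(n R'_{S_j}) words. Handling
    the subsets in the order v, the encoder finds words jointly typical with
    the source word (the codebooks are large enough for this), and sends the
    bin indices. By the Markov chain U - X - Y the side information is then
    typical with them too, so a decoder can only fail if a wrong choice of
    words inside the bins, differing exactly on some D'_l, is typical with the
    side information. Taking R_{S_j} + R'_{S_j} = I(X,U^-_{S_j}; U_{S_j}), which
    costs no rate, leaves only exp(o(n)) typical tuples of words in
    the whole codebook, so the union bound over all of them, rather than over
    the encoder's choice alone, needs no more than condition (ii). Time sharing
    then gives the convex envelope. *)

Set Implicit Arguments.
Unset Strict Implicit.

Local Open Scope R_scope.

(** The obstacle: the encoder's choice depends on the whole codebook, so the words left unchosen are
    not independent of it. The union bound therefore runs over pairs, an arbitrary tuple and an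
    alternative to it inside the same bins. For a fixed pair the alternative words are fresh and the
    two typicality events decouple. The first event is paid for by the chain rule: the rates
    I(X,U^-_{S_j}; U_{S_j}) sum exactly to the exponent of joint typicality of a full tuple with the
    source word. The second is beaten by shrinking every bin by a factor exp(n Delta). Equality of R
    + R' with I is free: passing to min(R', I) only lowers the left side of (ii), and I - min(R', I)
    = max(I - R', 0) is still at most R because R is nonnegative. Typicality bounds the relative
    deviation of the average of every nonnegative observable, so null letters, empirical entropies
    and distortions are all handled by one inequality. *)

HB.instance Definition _ := Monoid.isComLaw.Build R 0 Rplus
  (fun x y z => esym (Rplus_assoc x y z)) Rplus_comm Rplus_0_l.
HB.instance Definition _ := Monoid.isComLaw.Build R 1 Rmult
  (fun x y z => esym (Rmult_assoc x y z)) Rmult_comm Rmult_1_l.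
HB.instance Definition _ := Monoid.isMulLaw.Build R 0 Rmult Rmult_0_l Rmult_0_r.
HB.instance Definition _ := Monoid.isAddLaw.Build R Rmult Rplus
  Rmult_plus_distr_r Rmult_plus_distr_l.

Notation "\sum_ ( i <- r | P ) F" := (\big[Rplus/0]_(i <- r | P%B) F) : R_scope.
Notation "\sum_ ( i <- r ) F" := (\big[Rplus/0]_(i <- r) F) : R_scope.
Notation "\sum_ ( i : t | P ) F" := (\big[Rplus/0]_(i : t | P%B) F) : R_scope.
Notation "\sum_ ( i : t ) F" := (\big[Rplus/0]_(i : t) F) : R_scope.
Notation "\sum_ ( i 'in' A ) F" := (\big[Rplus/0]_(i in A) F) : R_scope.
Notation "\sum_ ( i | P ) F" := (\big[Rplus/0]_(i | P%B) F) : R_scope.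
Notation "\prod_ ( i <- r ) F" := (\big[Rmult/1]_(i <- r) F) : R_scope.
Notation "\prod_ ( i : t ) F" := (\big[Rmult/1]_(i : t) F) : R_scope.
Notation "\prod_ ( i : t | P ) F" := (\big[Rmult/1]_(i : t | P%B) F) : R_scope.
Notation "\prod_ ( i 'in' A ) F" := (\big[Rmult/1]_(i in A) F) : R_scope.
Notation "\prod_ ( i | P ) F" := (\big[Rmult/1]_(i | P%B) F) : R_scope.

(** * Finite sums and products of real numbers *)

Lemma sum_ge0 (I : Type) (r : seq I) (P : pred I) (F : I -> R) :
  (forall i, P i -> 0 <= F i) -> 0 <= \sum_(i <- r | P i) F i.
Proof. by move=> H; apply: (big_ind (fun x => 0 <= x)) => //; [lra|move=> *; lra]. Qed.

Lemma sum_le (I : Type) (r : seq I) (P : pred I) (F G : I -> R) :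
  (forall i, P i -> F i <= G i) -> \sum_(i <- r | P i) F i <= \sum_(i <- r | P i) G i.
Proof. by move=> H; apply: (big_ind2 (fun x y => x <= y)) => //; [lra|move=> *; lra]. Qed.

Lemma prod_ge0 (I : Type) (r : seq I) (P : pred I) (F : I -> R) :
  (forall i, P i -> 0 <= F i) -> 0 <= \big[Rmult/1]_(i <- r | P i) F i.
Proof.
move=> H; apply: (big_ind (fun x => 0 <= x)) => //; first lra.
by move=> *; apply: Rmult_le_pos.
Qed.

Lemma prod_gt0 (I : Type) (r : seq I) (P : pred I) (F : I -> R) :
  (forall i, P i -> 0 < F i) -> 0 < \big[Rmult/1]_(i <- r | P i) F i.
Proof.
move=> H; apply: (big_ind (fun x => 0 < x)) => //; first lra.
by move=> *; apply: Rmult_lt_0_compat.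
Qed.

Lemma prod_le (I : Type) (r : seq I) (P : pred I) (F G : I -> R) :
  (forall i, P i -> 0 <= F i <= G i) ->
  \big[Rmult/1]_(i <- r | P i) F i <= \big[Rmult/1]_(i <- r | P i) G i.
Proof.
move=> H; suff [] : 0 <= \big[Rmult/1]_(i <- r | P i) F i <= \big[Rmult/1]_(i <- r | P i) G i by [].
apply: (big_ind2 (fun x y => 0 <= x <= y)) => //; first lra.
move=> x1 x2 y1 y2 [? ?] [? ?]; split; first exact: Rmult_le_pos.
exact: Rmult_le_compat.
Qed.

Lemma prod_le1 (I : Type) (r : seq I) (P : pred I) (F : I -> R) :
  (forall i, P i -> 0 <= F i <= 1) -> \big[Rmult/1]_(i <- r | P i) F i <= 1.
Proof.
move=> H; apply: Rle_trans (prod_le _ H) _.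
by rewrite big1 //; lra.
Qed.

Lemma sum_const (I : Type) (r : seq I) (P : pred I) (x : R) :
  \sum_(i <- r | P i) x = INR (count P r) * x.
Proof.
elim: r => [|i r IH]; first by rewrite big_nil /=; lra.
by rewrite big_cons [count P _]/=; case: (P i); rewrite [nat_of_bool _]/= ?add0n ?add1n ?S_INR IH;
  lra.
Qed.

Lemma sum_constT (I : finType) (x : R) : \sum_(i : I) x = INR #|I| * x.
Proof. by rewrite sum_const count_predT cardT enumT. Qed.

Lemma sum_constn (n : nat) (x : R) : \sum_(i : 'I_n) x = INR n * x.
Proof. by rewrite sum_constT card_ord. Qed.

Lemma exp_le x y : x <= y -> exp x <= exp y.
Proof. by case=> [h|->]; [left; exact: exp_increasing|right]. Qed.

Lemma ln_le x y : 0 < x -> x <= y -> ln x <= ln y.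
Proof. by move=> x0 [h|->]; [left; exact: ln_increasing|right]. Qed.

Lemma prod_exp (I : Type) (r : seq I) (P : pred I) (F : I -> R) :
  \big[Rmult/1]_(i <- r | P i) exp (F i) = exp (\sum_(i <- r | P i) F i).
Proof.
apply: (big_ind2 (fun x y => x = exp y)) => //; first by rewrite exp_0.
by move=> x1 x2 y1 y2 -> ->; rewrite exp_plus.
Qed.

Lemma sum_term_le (I : finType) (F : I -> R) (i : I) :
  (forall j, 0 <= F j) -> F i <= \sum_(j : I) F j.
Proof.
move=> H; rewrite (bigD1 i) //=.
have : 0 <= \sum_(j | j != i) F j by apply: sum_ge0.
lra.
Qed.

Lemma sum_eq0 (I : finType) (F : I -> R) (i : I) :
  (forall j, 0 <= F j) -> \sum_(j : I) F j = 0 -> F i = 0.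
Proof. by move=> H E; have := H i; have := @sum_term_le _ F i H; lra. Qed.

Lemma mul_sumr (I : Type) (r : seq I) (P : pred I) (F : I -> R) (x : R) :
  x * \sum_(i <- r | P i) F i = \sum_(i <- r | P i) x * F i.
Proof. by rewrite big_distrr. Qed.

Lemma mul_suml (I : Type) (r : seq I) (P : pred I) (F : I -> R) (x : R) :
  (\sum_(i <- r | P i) F i) * x = \sum_(i <- r | P i) F i * x.
Proof. by rewrite big_distrl. Qed.

Lemma sum_prod (I J : finType) (F : I -> J -> R) :
  \sum_(f : {ffun I -> J}) \prod_(i : I) F i (f i) = \prod_(i : I) \sum_(j : J) F i j.
Proof. by rewrite bigA_distr_bigA. Qed.

Lemma sum_pair (I J : finType) (F : I * J -> R) :
  \sum_(p : I * J) F p = \sum_(i : I) \sum_(j : J) F (i, j).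
Proof. by rewrite pair_big; apply: eq_bigr => -[]. Qed.

Lemma sumN (I : Type) (r : seq I) (P : pred I) (F : I -> R) :
  \sum_(i <- r | P i) (- F i) = - \sum_(i <- r | P i) F i.
Proof. by apply: (big_ind2 (fun x y => x = - y)) => // *; lra. Qed.

Lemma sumB (I : Type) (r : seq I) (P : pred I) (F G : I -> R) :
  \sum_(i <- r | P i) (F i - G i) = \sum_(i <- r | P i) F i - \sum_(i <- r | P i) G i.
Proof. by rewrite /Rminus -sumN -big_split. Qed.

(** * Indicators of propositions and their union bounds *)

Definition ind (P : Prop) : R := if excluded_middle_informative P then 1 else 0.

Lemma ind1 (P : Prop) : P -> ind P = 1.
Proof. by rewrite /ind; case: excluded_middle_informative. Qed.

Lemma ind0 (P : Prop) : ~ P -> ind P = 0.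
Proof. by rewrite /ind; case: excluded_middle_informative. Qed.

Lemma ind_01 (P : Prop) : 0 <= ind P <= 1.
Proof. by rewrite /ind; case: excluded_middle_informative => ? /=; lra. Qed.

Lemma ind_le (P Q : Prop) : (P -> Q) -> ind P <= ind Q.
Proof.
move=> H; case: (excluded_middle_informative P) => p.
  by rewrite !ind1; [lra|exact: H|].
by rewrite (ind0 p); have := ind_01 Q; lra.
Qed.

Lemma ind_not (P : Prop) : ind (~ P) = 1 - ind P.
Proof.
case: (excluded_middle_informative P) => p; last by rewrite (ind0 p) ind1 //; lra.
by rewrite (ind1 p) ind0 ?Rminus_diag //; apply.
Qed.

Lemma ind_and (P Q : Prop) : ind (P /\ Q) = ind P * ind Q.
Proof.
case: (excluded_middle_informative P) => p; last by rewrite (ind0 p) ind0 ?Rmult_0_l //; case.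
case: (excluded_middle_informative Q) => q; last by rewrite (ind0 q) ind0 ?Rmult_0_r //; case.
by rewrite !ind1 // ?Rmult_1_r.
Qed.

Lemma ind_or (P Q : Prop) : ind (P \/ Q) <= ind P + ind Q.
Proof.
have [? ?] := ind_01 P; have [? ?] := ind_01 Q.
case: (excluded_middle_informative P) => p.
  by rewrite (ind1 p); have [_ h] := ind_01 (P \/ Q); lra.
apply: Rle_trans (_ : _ <= ind Q) _; last lra.
by apply: ind_le; case.
Qed.

Lemma ind_exists (I : finType) (P : I -> Prop) :
  ind (exists i, P i) <= \sum_(i : I) ind (P i).
Proof.
case: (excluded_middle_informative (exists i, P i)) => [[i p]|np].
  rewrite ind1; last by exists i.
  rewrite -(ind1 p); apply: (@sum_term_le _ (fun i => ind (P i))) => j.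
  by case: (ind_01 (P j)).
by rewrite (ind0 np); apply: sum_ge0 => i _; case: (ind_01 (P i)).
Qed.

Lemma ind_forall (I : finType) (P : I -> Prop) :
  ind (forall i, P i) = \prod_(i : I) ind (P i).
Proof.
case: (excluded_middle_informative (forall i, P i)) => [p|np].
  by rewrite ind1 // big1 // => i _; rewrite ind1.
rewrite (ind0 np); have [i ni] : exists i, ~ P i.
  by apply: Classical_Prop.NNPP => h; apply: np => i; apply: Classical_Prop.NNPP => ni; apply: h;
    exists i.
by rewrite (bigD1 i) //= (ind0 ni) Rmult_0_l.
Qed.

Lemma fun_choice (A B : Type) (R : A -> B -> Prop) :
  (forall a, exists b, R a b) -> exists f : A -> B, forall a, R a (f a).
Proof.
move=> h; exists (fun a => proj1_sig (constructive_indefinite_description _ (h a))) => a.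
exact: (proj2_sig (constructive_indefinite_description _ (h a))).
Qed.

(** * Independent coordinates: resampling and second moments *)

Section Mix.
Context {I T : finType} (mu : I -> T -> R) (C : pred I).

Definition mix (f g : {ffun I -> T}) : {ffun I -> T} := [ffun i => if C i then g i else f i].

(* The swap (f, g) |-> (mix f g, mix g f) is an involution preserving the
   product weight of (f, g). *)
Lemma mix_fubini (F : {ffun I -> T} -> R) :
  (forall i, \sum_(t : T) mu i t = 1) ->
  \sum_(f : {ffun I -> T}) \prod_(i : I) mu i (f i) * F f =
  \sum_(f : {ffun I -> T}) \prod_(i : I) mu i (f i) *
     \sum_(g : {ffun I -> T}) \prod_(i : I) mu i (g i) * F (mix f g).
Proof.
move=> Hmu.
have one : \sum_(g : {ffun I -> T}) \prod_(i : I) mu i (g i) = 1.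
  by rewrite sum_prod big1 // => i _; rewrite Hmu.
pose W (p : {ffun I -> T} * {ffun I ->
  T}) := \prod_(i : I) mu i (p.1 i) * \prod_(i : I) mu i (p.2 i).
transitivity (\sum_(p : {ffun I -> T} * {ffun I -> T}) W p * F p.1).
  rewrite -(pair_big predT predT (fun f g => W (f, g) * F f)) /=.
  apply: eq_bigr => f _; rewrite /W /=.
  transitivity (\prod_(i : I) mu i (f i) * F f * \sum_(g : {ffun I -> T}) \prod_(i : I) mu i (g i)).
    by rewrite one Rmult_1_r.
  by rewrite big_distrr /=; apply: eq_bigr => g _; lra.
transitivity (\sum_(p : {ffun I -> T} * {ffun I -> T}) W p * F (mix p.1 p.2)); last first.
  rewrite -(pair_big predT predT (fun f g => W (f, g) * F (mix f g))) /=.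
  apply: eq_bigr => f _; rewrite big_distrr /=; apply: eq_bigr => g _; rewrite /W /=; lra.
pose sw (p : {ffun I -> T} * {ffun I -> T}) := (mix p.1 p.2, mix p.2 p.1).
have swK : involutive sw.
  move=> [f g]; rewrite /sw /=; congr pair; apply/ffunP => i; rewrite !ffunE; by case: (C i).
rewrite (reindex_inj (inv_inj swK)) /=.
apply: eq_bigr => [[f g]] _; congr (_ * _).
rewrite /W /= -!big_split /=; apply: eq_bigr => i _; rewrite !ffunE.
by case: (C i); lra.
Qed.
End Mix.

(** Variance of a sum of independent centred terms, for Chebyshev's inequality: in the expanded
    square every off-diagonal product contains a factor of mean 0. *)
Lemma second_moment (I T : finType) (mu : I -> T -> R) (phi : I -> T -> R) :
  (forall i, \sum_(t : T) mu i t = 1) ->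
  (forall i, \sum_(t : T) mu i t * phi i t = 0) ->
  \sum_(f : {ffun I -> T}) \prod_(i : I) mu i (f i) * (\sum_(i : I) phi i (f i)) ^ 2 =
  \sum_(i : I) \sum_(t : T) mu i t * phi i t ^ 2.
Proof.
move=> H1 H0.
(* [G] spreads the product of the terms [k] and [k'] over all coordinates, so that each summand of
   the square integrates coordinate by coordinate. *)
pose G k k' i t := (if i == k then phi k t else 1) * (if i == k' then phi k' t else 1).
transitivity (\sum_(f : {ffun I -> T}) \sum_(k : I) \sum_(k' : I)
   \prod_(i : I) (mu i (f i) * G k k' i (f i))).
  apply: eq_bigr => f _; rewrite /= Rmult_1_r big_distrl /= big_distrr /=.
  apply: eq_bigr => k _; rewrite big_distrr big_distrr /=; apply: eq_bigr => k' _.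
  rewrite big_split /= /G big_split /=; congr (_ * (_ * _)).
    by rewrite -big_mkcond /= big_pred1_eq.
  by rewrite -big_mkcond /= big_pred1_eq.
have key k k' : \sum_(f : {ffun I -> T}) \prod_(i : I) (mu i (f i) * G k k' i (f i)) =
    \prod_(i : I) \sum_(t : T) mu i t * G k k' i t.
  exact: (sum_prod (fun i t => mu i t * G k k' i t)).
rewrite exchange_big; apply: eq_bigr => k _ /=.
rewrite exchange_big (bigD1 k) //= [X in _ + X]big1 ?Rplus_0_r.
  rewrite key (bigD1 k) //= [X in _ * X]big1 ?Rmult_1_r.
    by apply: eq_bigr => t _; rewrite /G eqxx; lra.
  move=> i ik; apply: etrans (H1 i); apply: eq_bigr => t _; rewrite /G (negbTE ik); lra.
move=> k' kk'; rewrite key (bigD1 k) //= [X in X * _](_ : _ = 0) ?Rmult_0_l //.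
apply: etrans (H0 k); apply: eq_bigr => t _; rewrite /G eqxx eq_sym (negbTE kk'); lra.
Qed.

(** * Robust typicality *)

(** Computes averages over a random codebook of tests made on distinct codewords. Injectivity on [A]
    puts at most one test on each coordinate, and an untested coordinate integrates to 1. *)
Lemma marginal_prod (I J T : finType) (mu : I -> T -> R) (A : {set J}) (iota : J -> I)
    (phi : J -> T -> R) :
  (forall i, \sum_(t : T) mu i t = 1) -> {in A &, injective iota} ->
  \sum_(f : {ffun I -> T}) \prod_(i : I) mu i (f i) * \prod_(j in A) phi j (f (iota j)) =
  \prod_(j in A) \sum_(t : T) mu (iota j) t * phi j t.
Proof.
move=> H1 inj.
pose psi i t := \prod_(j | (j \in A) && (iota j == i)) phi j t.
transitivity (\sum_(f : {ffun I -> T}) \prod_(i : I) (mu i (f i) * psi i (f i))).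
  apply: eq_bigr => f _; rewrite big_split /=; congr (_ * _).
  rewrite (partition_big iota predT) //=; apply: eq_bigr => i _.
  by apply: eq_bigr => j /andP[_ /eqP ->].
rewrite (sum_prod (fun i t => mu i t * psi i t)).
rewrite [RHS](partition_big iota predT) //=; apply: eq_bigr => i _.
case: (pickP (fun j => (j \in A) && (iota j == i))) => [j0 /andP[Aj0 /eqP ij0]|none].
  have E : (fun j => (j \in A) && (iota j == i)) =1 pred1 j0.
    move=> j /=; apply/andP/eqP => [[Aj /eqP ij]|->]; last by rewrite Aj0 ij0.
    by apply: inj; rewrite ?ij ?ij0.
  rewrite (big_pred1 j0) //; apply: eq_bigr => t _; rewrite ij0 /psi (big_pred1 j0) //.
rewrite [RHS]big_pred0 //; apply: etrans (H1 i); apply: eq_bigr => t _.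
by rewrite /psi big_pred0 // Rmult_1_r.
Qed.

Lemma marginal (I T : finType) (mu : I -> T -> R) (i : I) (phi : T -> R) :
  (forall i, \sum_(t : T) mu i t = 1) ->
  \sum_(f : {ffun I -> T}) \prod_(i : I) mu i (f i) * phi (f i) = \sum_(t : T) mu i t * phi t.
Proof.
move=> H1; have := @marginal_prod I I T mu [set i] (fun i => i) (fun _ => phi) H1.
rewrite big_set1 => <-; last by move=> ? ? ? ?.
by apply: eq_bigr => f _; rewrite big_set1.
Qed.

Section Typicality.
Context {Om : finType} (q : Om -> R).
Context (q0 : forall w, 0 <= q w) (q1 : \sum_(w : Om) q w = 1).

Definition esp (f : Om -> R) := \sum_(w : Om) q w * f w.

Lemma esp_ge0 f : (forall w, 0 <= f w) -> 0 <= esp f.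
Proof. by move=> f0; apply: sum_ge0 => w _; apply: Rmult_le_pos. Qed.

Lemma prob_ge0 (T : eqType) (Z : Om -> T) t : 0 <= prob_of q Z t.
Proof. exact: sum_ge0. Qed.

Lemma prob_esp (T : eqType) (Z : Om -> T) t : prob_of q Z t = esp (fun w => ind (Z w = t)).
Proof.
rewrite /prob_of big_mkcond; apply: eq_bigr => w _.
by case: eqP => h; [rewrite ind1 //; lra|rewrite ind0 //; lra].
Qed.

Lemma prob_le1 (T : eqType) (Z : Om -> T) t : prob_of q Z t <= 1.
Proof.
rewrite prob_esp -q1; apply: sum_le => w _.
have [_ h] := ind_01 (Z w = t); have h0 := q0 w.
nra.
Qed.

Lemma prob_ge (T : eqType) (Z : Om -> T) w : q w <= prob_of q Z (Z w).
Proof.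
rewrite /prob_of (bigD1 w) //=.
have : 0 <= \sum_(i | (Z i == Z w) && (i != w)) q i by apply: sum_ge0.
lra.
Qed.

Lemma prob_gt0 (T : eqType) (Z : Om -> T) t :
  0 < prob_of q Z t -> exists2 w, Z w = t & 0 < q w.
Proof.
move=> h; apply: Classical_Prop.NNPP => no; move: h; rewrite /prob_of big1; first lra.
move=> w /eqP Zw; have := q0 w; case: (Req_dec (q w) 0) => // ? ?.
by case: no; exists w => //; lra.
Qed.

Lemma prob_null (T : eqType) (Z : Om -> T) : esp (fun w => ind (~ 0 < prob_of q Z (Z w))) = 0.
Proof.
apply: big1 => w _; case: (Rle_lt_dec (q w) 0) => h.
  have -> : q w = 0 by have := q0 w; lra.
  by rewrite Rmult_0_l.
rewrite ind0; first lra.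
by move=> []; have := prob_ge Z w; lra.
Qed.

Definition vals (T : eqType) (Z : Om -> T) := undup [seq Z w | w <- enum Om].

Lemma mem_vals (T : eqType) (Z : Om -> T) w : Z w \in vals Z.
Proof. by rewrite mem_undup map_f // mem_enum. Qed.

Lemma esp_vals (T : eqType) (Z : Om -> T) (f : T -> R) :
  esp (fun w => f (Z w)) = \sum_(t <- vals Z) prob_of q Z t * f t.
Proof.
transitivity (\sum_(w : Om) \sum_(t <- vals Z | Z w == t) q w * f t).
  apply: eq_bigr => w _; rewrite -big_filter.
  have -> : [seq t <- vals Z | Z w == t] = [:: Z w].
    rewrite -(filter_pred1_uniq (undup_uniq _) (mem_vals Z w)).
    by apply: eq_filter => t /=; rewrite eq_sym.
  by rewrite big_seq1.
rewrite (exchange_big_dep predT) //=; apply: eq_bigr => t _.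
by rewrite /prob_of mul_suml.
Qed.

Definition surprisal (T : eqType) (Z : Om -> T) t := - ln (prob_of q Z t).

Lemma ln_nonpos x : x <= 1 -> ln x <= 0.
Proof.
move=> h; case: (Rlt_dec 0 x) => x0.
  rewrite -ln_1; case: h => h; [left; exact: ln_increasing|rewrite h; lra].
by rewrite /ln; case: Rlt_dec => // _; lra.
Qed.

Lemma surprisal_ge0 (T : eqType) (Z : Om -> T) t : 0 <= surprisal Z t.
Proof. by have := ln_nonpos (prob_le1 Z t); rewrite /surprisal; lra. Qed.

Lemma entropyE (T : eqType) (Z : Om -> T) : entropy q Z = esp (fun w => surprisal Z (Z w)).
Proof.
rewrite (esp_vals Z (surprisal Z)); apply: eq_bigr => t _; rewrite /surprisal; lra.
Qed.

Lemma entropy_ge0 (T : eqType) (Z : Om -> T) : 0 <= entropy q Z.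
Proof. by rewrite entropyE; apply: esp_ge0 => w; apply: surprisal_ge0. Qed.

Lemma entropy_recode (T T' : eqType) (Z : Om -> T) (Z' : Om -> T') :
  (forall w w', (Z w == Z w') = (Z' w == Z' w')) -> entropy q Z = entropy q Z'.
Proof.
move=> h; rewrite !entropyE; apply: eq_bigr => w _; congr (_ * - ln _).
by rewrite /prob_of; apply: eq_bigl => w'; rewrite h.
Qed.

(* Robust typicality, phrased with nonnegative observables instead of letter
   counts so that it passes to functions of [Z] for free. *)
Definition typ {T : Type} (n : nat) (eps : R) (Z : Om -> T) (z : 'I_n -> T) : Prop :=
  forall f : T -> R, (forall t, 0 <= f t) ->
  Rabs (\sum_(k : 'I_n) f (z k) - INR n * esp (fun w => f (Z w)))
    <= eps * (INR n * esp (fun w => f (Z w))).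

Lemma typ_map (T T' : Type) (n : nat) eps (Z : Om -> T) (z : 'I_n -> T)
    (Z' : Om -> T') (z' : 'I_n -> T') (h : T -> T') :
  (forall w, Z' w = h (Z w)) -> (forall k, z' k = h (z k)) ->
  typ eps Z z -> typ eps Z' z'.
Proof.
move=> hZ hz tz f f0; have := tz (fun t => f (h t)) (fun t => f0 _).
rewrite (eq_bigr (fun k => f (z' k))) => [|k _]; last by rewrite hz.
by rewrite [esp _](_ : _ = esp (fun w => f (Z' w))) //; apply: eq_bigr => w _; rewrite hZ.
Qed.

(** The indicator of the null letters has mean 0, so the relative error bound forces its sum over
    the word to be 0. *)
Lemma typ_pos (T : eqType) (n : nat) eps (Z : Om -> T) (z : 'I_n -> T) k :
  typ eps Z z -> 0 < prob_of q Z (z k).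
Proof.
move=> tz; have := tz (fun t => ind (~ 0 < prob_of q Z t)) (fun t => proj1 (ind_01 _)).
rewrite (prob_null Z) !Rmult_0_r => h.
have h0 : \sum_(k0 : 'I_n) ind (~ 0 < prob_of q Z (z k0)) = 0.
  by move: h; split_Rabs; lra.
apply: Classical_Prop.NNPP => np.
have := @sum_eq0 _ (fun k0 => ind (~ 0 < prob_of q Z (z k0))) k (fun j => proj1 (ind_01 _)) h0.
rewrite ind1 //; lra.
Qed.

(** The equipartition property: the surprisal is a nonnegative observable, and its mean is the
    entropy. *)
Lemma typ_surprisal (T : eqType) (n : nat) eps (Z : Om -> T) (z : 'I_n -> T) :
  typ eps Z z ->
  Rabs (\sum_(k : 'I_n) surprisal Z (z k) - INR n * entropy q Z) <= eps * (INR n * entropy q Z).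
Proof. by rewrite entropyE; apply; apply: surprisal_ge0. Qed.

(** A nonnegative observable is a nonnegative combination of letter indicators, so relative errors
    on the counts add up to the same relative error. *)
Lemma typ_counts (T : eqType) (n : nat) eps (Z : Om -> T) (z : 'I_n -> T) :
  (forall k, 0 < prob_of q Z (z k)) ->
  (forall w, 0 < prob_of q Z (Z w) ->
     Rabs (\sum_(k : 'I_n) ind (z k = Z w) - INR n * prob_of q Z (Z w))
       <= eps * (INR n * prob_of q Z (Z w))) ->
  typ eps Z z.
Proof.
move=> zpos hc f f0.
have zv k : z k \in vals Z.
  by have [w <- _] := prob_gt0 (zpos k); exact: mem_vals.
have -> : \sum_(k : 'I_n) f (z k) = \sum_(t <- vals Z) f t * \sum_(k : 'I_n) ind (z k = t).
  transitivity (\sum_(k : 'I_n) \sum_(t <- vals Z) f t * ind (z k = t)).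
    apply: eq_bigr => k _; rewrite (bigD1_seq (z k)) ?undup_uniq ?zv //=.
    rewrite ind1 // big1 => [|t tz]; first lra.
    by rewrite ind0 ?Rmult_0_r // => e; rewrite e eqxx in tz.
  by rewrite exchange_big; apply: eq_bigr => t _; rewrite mul_sumr.
rewrite (esp_vals Z f) !mul_sumr -sumB /vals.
have vw t : t \in undup [seq Z w | w <- enum Om] -> exists w, t = Z w.
  by rewrite mem_undup => /mapP[w _ ->]; exists w.
elim: (undup _) vw => [|t r IH] vw; first by rewrite !big_nil Rabs_R0; lra.
rewrite !big_cons; apply: Rle_trans (Rabs_triang _ _) _; apply: Rplus_le_compat; last first.
  by apply: IH => t' ht'; apply: vw; rewrite inE ht' orbT.
have [w ->] : exists w, t = Z w by apply: vw; rewrite mem_head.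
set N := \sum_(k : 'I_n) _; set p := prob_of q Z (Z w).
have -> : f (Z w) * N - INR n * (p * f (Z w)) = f (Z w) * (N - INR n * p) by lra.
rewrite Rabs_mult Rabs_pos_eq //.
have -> : eps * (INR n * (p * f (Z w))) = f (Z w) * (eps * (INR n * p)) by lra.
apply: Rmult_le_compat_l => //.
have [p0|pn0] := Rle_lt_dec p 0; last exact: hc.
have p00 : p = 0 by have := prob_ge0 Z (Z w); rewrite -/p; lra.
rewrite p00 [N]big1; first by rewrite !Rmult_0_r Rminus_diag Rabs_R0; lra.
move=> k _; rewrite ind0 // => e; have := zpos k; rewrite e -/p; lra.
Qed.

(* The constant is uniform in the typical word [v]: this replaces both the
   conditional typicality lemma and the Markov lemma. *)
Lemma cond_typ (S T : eqType) (B : finType) (V : Om -> S) (Z : Om -> T)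
    (ka : S -> B -> R) (h : S -> B -> T) (eps : R) :
  0 < eps -> (forall s b, 0 <= ka s b) ->
  (forall s, 0 < prob_of q V s -> \sum_(b : B) ka s b = 1) ->
  (forall F : T -> R,
     esp (fun w => F (Z w)) = esp (fun w => \sum_(b : B) ka (V w) b * F (h (V w) b))) ->
  exists C : R, forall (n : nat) (v : 'I_n -> S), (0 < n)%nat -> typ eps V v ->
    \sum_(b : {ffun 'I_n -> B}) \prod_(k : 'I_n) ka (v k) (b k) *
      ind (~ typ (2 * eps) Z (fun k => h (v k) (b k))) <= C / INR n.
Proof.
move=> eps0 ka0 ka1 law.
(* The Chebyshev constants of the letters [Z w]; a null letter contributes 0, because the inverse of
   0 is 0. *)
exists (\sum_(w : Om) / (eps * prob_of q Z (Z w)) ^ 2) => n v n0 tv.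
have nR : 0 < INR n by apply: lt_0_INR; apply/ltP.
have ka1' k : \sum_(b : B) ka (v k) b = 1 by apply: ka1; apply: typ_pos tv.
pose W (b : {ffun 'I_n -> B}) := \prod_(k : 'I_n) ka (v k) (b k).
have W0 b : 0 <= W b by apply: prod_ge0.
(* Typicality can fail in two ways: a null letter occurs, which has probability 0, or the count of a
   letter of positive probability is off. *)
pose bad0 (b : {ffun 'I_n -> B}) k := ~ 0 < prob_of q Z (h (v k) (b k)).
pose bad1 (b : {ffun 'I_n -> B}) w := 0 < prob_of q Z (Z w) /\
  2 * eps * (INR n * prob_of q Z (Z w)) <
    Rabs (\sum_(k : 'I_n) ind (h (v k) (b k) = Z w) - INR n * prob_of q Z (Z w)).
apply: (@Rle_trans _ (\sum_(b : {ffun 'I_n -> B}) W b *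
    (\sum_(k : 'I_n) ind (bad0 b k) + \sum_(w : Om) ind (bad1 b w)))).
  apply: sum_le => b _; apply: Rmult_le_compat_l; first exact: W0.
  apply: (@Rle_trans _ (ind ((exists k, bad0 b k) \/ (exists w, bad1 b w)))).
    apply: ind_le => nt; apply: Classical_Prop.NNPP => /Classical_Prop.not_or_and[nb0 nb1];
      apply: nt.
    apply: typ_counts => [k|w pw].
      by apply: Classical_Prop.NNPP => hk; apply: nb0; exists k.
    by apply: Rnot_lt_le => hw; apply: nb1; exists w.
  apply: Rle_trans (ind_or _ _) _; apply: Rplus_le_compat; exact: ind_exists.
rewrite (eq_bigr (fun b => W b * \sum_(k : 'I_n) ind (bad0 b k) +
   W b * \sum_(w : Om) ind (bad1 b w))) => [|b _]; last by rewrite Rmult_plus_distr_l.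
rewrite big_split /= [X in X + _](_ : _ = 0) ?Rplus_0_l; last first.
  rewrite (eq_bigr (fun b => \sum_(k : 'I_n) W b * ind (bad0 b k))) => [|b _];
    last by rewrite mul_sumr.
  rewrite exchange_big big1 // => k _.
  rewrite (@marginal _ _ (fun k b => ka (v k) b) k
    (fun b => ind (~ 0 < prob_of q Z (h (v k) b))) ka1').
  (* The conditional probability of a null letter has mean 0, so typicality of [v] makes it vanish
     at every [v k]. *)
  pose g s := \sum_(b : B) ka s b * ind (~ 0 < prob_of q Z (h s b)).
  have g0 s : 0 <= g s.
    by apply: sum_ge0 => b _; apply: Rmult_le_pos => //; case: (ind_01 (~ 0 < prob_of q Z (h s b))).
  have := tv g g0; rewrite -(law (fun t => ind (~ 0 < prob_of q Z t))) prob_null !Rmult_0_r => h0.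
  have h00 : \sum_(k : 'I_n) g (v k) = 0 by move: h0; split_Rabs; lra.
  exact: (@sum_eq0 _ (fun k => g (v k)) k (fun j => g0 _) h00).
rewrite (eq_bigr (fun b => \sum_(w : Om) W b * ind (bad1 b w))) => [|b _]; last by rewrite mul_sumr.
rewrite exchange_big /Rdiv mul_suml /=; apply: sum_le => w _.
set p := prob_of q Z (Z w).
have [p0|pn0] := Rle_lt_dec p 0.
  have -> : p = 0 by have := prob_ge0 Z (Z w); rewrite -/p; lra.
  rewrite Rmult_0_r Rmult_0_l Rinv_0 Rmult_0_l big1; first lra.
  by move=> b _; rewrite ind0 ?Rmult_0_r // => -[]; rewrite -/p; lra.
(* Splits the tolerance [2 * eps]: typicality of [v], tested on the conditional probability [g],
   keeps the sum of the [g (v k)] within [eps] of its target, so a bad count forces the centred sum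
   of [phi] beyond the other [eps]. *)
pose g s := \sum_(b : B) ka s b * ind (h s b = Z w).
have g0 s : 0 <= g s.
  by apply: sum_ge0 => b _; apply: Rmult_le_pos => //; case: (ind_01 (h s b = Z w)).
have g1 k : g (v k) <= 1.
  rewrite -(ka1' k); apply: sum_le => b _.
  by have [_ ?] := ind_01 (h (v k) b = Z w); have := ka0 (v k) b; nra.
have gE : esp (fun w' => g (V w')) = p by rewrite /p prob_esp (law (fun t => ind (t = Z w))).
have := tv g g0; rewrite gE => hg.
pose phi k b := ind (h (v k) b = Z w) - g (v k).
have phi0 k : \sum_(b : B) ka (v k) b * phi k b = 0.
  rewrite (eq_bigr (fun b => ka (v k) b * ind (h (v k) b = Z w) - ka (v k) b * g (v k)));
    last by move=> b _; rewrite /phi; lra.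
  by rewrite sumB -mul_suml /= ka1' -/(g (v k)); lra.
have den : 0 < (eps * (INR n * p)) ^ 2 by apply: pow_lt; apply: Rmult_lt_0_compat => //;
  apply: Rmult_lt_0_compat.
(* Chebyshev's inequality; each centred indicator then has second moment at most 1. *)
apply: (@Rle_trans _ (\sum_(b : {ffun 'I_n ->
  B}) (W b * (\sum_(k : 'I_n) phi k (b k)) ^ 2) / (eps * (INR n * p)) ^ 2)).
  apply: sum_le => b _; rewrite /Rdiv Rmult_assoc; apply: Rmult_le_compat_l; first exact: W0.
  set x := (X in X ^ 2).
  have [hb|hb] := excluded_middle_informative (bad1 b w); last first.
    by rewrite (ind0 hb); apply: Rmult_le_pos; [exact: pow2_ge_0|left; exact: Rinv_0_lt_compat].
  rewrite (ind1 hb); apply: (Rmult_le_reg_r ((eps * (INR n * p)) ^ 2)) => //.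
  rewrite Rmult_assoc Rinv_l ?Rmult_1_r ?Rmult_1_l; last lra.
  rewrite -(pow2_abs x); apply: pow_incr; split.
    by apply: Rmult_le_pos; [lra|apply: Rmult_le_pos; lra].
  have xE : x = \sum_(k : 'I_n) ind (h (v k) (b k) = Z w) - \sum_(k : 'I_n) g (v k) by rewrite /x
    /phi sumB.
  case: hb => _; rewrite -/p; move: hg; rewrite xE; set a := \sum_(k : 'I_n) g _;
    set c := \sum_(k : 'I_n) ind _.
  by move=> h1 h2; move: h1 h2; split_Rabs; lra.
rewrite /Rdiv -mul_suml /= (@second_moment _ _ (fun k b => ka (v k) b) phi ka1' phi0).
apply: (@Rle_trans _ (INR n * / (eps * (INR n * p)) ^ 2)); last first.
  by right; field; lra.
apply: Rmult_le_compat_r; first by left; apply: Rinv_0_lt_compat.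
rewrite -[INR n]Rmult_1_r -sum_constn; apply: sum_le => k _.
rewrite -(ka1' k); apply: sum_le => b _.
have [? ?] := ind_01 (h (v k) b = Z w); have h1 := g0 (v k); have h2 := g1 k.
suff : phi k b ^ 2 <= 1 by have := ka0 (v k) b; nra.
by rewrite /phi; nra.
Qed.
End Typicality.

(** * Change of measure on typical words *)

Lemma abs_bounds x y z : Rabs (x - y) <= z -> y - z <= x <= y + z.
Proof. by split_Rabs; lra. Qed.

Section Tilting.
Context {Om : finType} (q : Om -> R).
Context (q0 : forall w, 0 <= q w) (q1 : \sum_(w : Om) q w = 1).

Notation nlp := (surprisal q).
Notation H := (entropy q).
Notation typ := (typ q).
Notation pr := (prob_of q).

Definition wordp (n : nat) (b : {ffun 'I_n -> Om}) : R := \prod_(k : 'I_n) q (b k).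

Lemma wordp_ge0 n b : 0 <= @wordp n b.
Proof. exact: prod_ge0. Qed.

Lemma wordp_sum n : \sum_(b : {ffun 'I_n -> Om}) wordp b = 1.
Proof. by rewrite /wordp (sum_prod (fun _ => q)) big1 // => k _; rewrite q1. Qed.

Lemma prob_exp (T : eqType) (Z : Om -> T) t : 0 < pr Z t -> pr Z t = exp (- nlp Z t).
Proof. by move=> h; rewrite /surprisal Ropp_involutive exp_ln. Qed.

(* The law of [U] given [V = s], as a reweighting of [q]. *)
Definition tilt (S T : eqType) (V : Om -> S) (U : Om -> T) (s : S) (b : Om) : R :=
  q b * (pr (fun w => (V w, U w)) (s, U b) / (pr V s * pr U (U b))).

Lemma tilt_ge0 (S T : eqType) (V : Om -> S) (U : Om -> T) s b : 0 <= tilt V U s b.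
Proof.
apply: Rmult_le_pos => //; apply: Rmult_le_pos; first exact: prob_ge0.
have := prob_ge0 q0 V s; have := prob_ge0 q0 U (U b).
set x := pr U _; set y := pr V _ => x0 y0.
have [->|yx] := Req_dec (y * x) 0; first by rewrite Rinv_0; lra.
by left; apply: Rinv_0_lt_compat; nra.
Qed.

(** Cancels the mass of the class of [w] under [U]; the factor [q w] covers the case where that mass
    is 0. *)
Lemma prob_div (T : eqType) (U : Om -> T) w (x : R) :
  q w * (x * (\sum_(b : Om) q b * ind (U b = U w)) / pr U (U w)) = q w * x.
Proof.
have [q00|qw] := Rle_lt_dec (q w) 0.
  have -> : q w = 0 by have := q0 w; lra.
  by rewrite !Rmult_0_l.
rewrite -[\sum_(b : Om) _](prob_esp q U (U w)) /Rdiv Rmult_assoc Rinv_r ?Rmult_1_r //.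
by have := prob_ge q0 U w; lra.
Qed.

Lemma tilt_law (S T : eqType) (V : Om -> S) (U : Om -> T) s (g : T -> R) :
  \sum_(b : Om) tilt V U s b * g (U b) = \sum_(w : Om) q w * (ind (V w = s) / pr V s * g (U w)).
Proof.
transitivity (\sum_(b : Om) \sum_(w : Om) q w *
   (ind (V w = s) / pr V s * g (U w) * (q b * ind (U b = U w)) / pr U (U w))).
  apply: eq_bigr => b _; rewrite /tilt prob_esp /esp /Rdiv.
  rewrite mul_suml mul_sumr mul_suml; apply: eq_bigr => w _.
  have -> : ind ((V w, U w) = (s, U b)) = ind (V w = s) * ind (U b = U w).
    rewrite -ind_and; apply: Rle_antisym; apply: ind_le; first by move=> [-> ->].
    by move=> [-> ->].
  have [e|ne] := excluded_middle_informative (U b = U w); last by rewrite (ind0 ne); lra.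
  rewrite -e Rinv_mult; lra.
rewrite exchange_big /=; apply: eq_bigr => w _.
rewrite -[RHS](prob_div U) -mul_sumr; congr (_ * _).
by rewrite /Rdiv -mul_suml -mul_sumr.
Qed.

Lemma tilt_sum (S T : eqType) (V : Om -> S) (U : Om -> T) s :
  0 < pr V s -> \sum_(b : Om) tilt V U s b = 1.
Proof.
move=> ps; transitivity (\sum_(b : Om) tilt V U s b * 1); first by apply: eq_bigr => b _; lra.
rewrite (tilt_law V U s (fun _ => 1)) -[RHS](Rinv_r (pr V s)); last lra.
by rewrite {2}prob_esp /esp mul_suml; apply: eq_bigr => w _; rewrite /Rdiv; lra.
Qed.

(** This is the hypothesis on the law in [cond_typ], for the kernel [tilt]. *)
Lemma tilt_joint_law (S T : eqType) (V : Om -> S) (U : Om -> T) (F : S * T -> R) :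
  esp q (fun w => F (V w, U w)) = esp q (fun w => \sum_(b : Om) tilt V U (V w) b * F (V w, U b)).
Proof.
rewrite /esp [RHS](eq_bigr (fun w =>
  \sum_(w' : Om) q w' * (F (V w', U w') * (q w * ind (V w = V w')) / pr V (V w')))).
  rewrite exchange_big /=; apply: eq_bigr => w _.
  rewrite -[LHS](prob_div V) -mul_sumr; congr (_ * _).
  by rewrite /Rdiv -mul_suml -mul_sumr.
move=> w _; rewrite (tilt_law V U (V w) (fun t => F (V w, t))) mul_sumr.
apply: eq_bigr => w' _.
have [e|ne] := excluded_middle_informative (V w = V w').
  by rewrite (ind1 e) -e ind1 //; lra.
by rewrite (ind0 ne) ind0; [lra|move=> e; apply: ne].
Qed.

(** Change of measure: under the tilted law joint typicality has probability at least
    [1 - C / INR n] by [cond_typ], and on jointly typical words the tilted density is at most the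
    exponential of n times the mutual information plus the typicality error. *)
Lemma tilt_lower (S T : eqType) (V : Om -> S) (U : Om -> T) eps : 0 < eps ->
  exists C : R, forall (n : nat) (v : 'I_n -> S), (0 < n)%nat -> typ eps V v ->
  (1 - C / INR n) * exp (- (INR n * (minfo q V U +
       2 * eps * (H V + H U + H (fun w => (V w, U w)))))) <=
  \sum_(b : {ffun 'I_n -> Om}) wordp b *
     ind (typ (2 * eps) (fun w => (V w, U w)) (fun k => (v k, U (b k)))).
Proof.
move=> eps0.
have [C HC] := @cond_typ Om q q0 S (S * T)%type Om V (fun w => (V w, U w)) (tilt V U)
   (fun s b => (s, U b)) eps eps0 (tilt_ge0 V U) (@tilt_sum _ _ V U) (@tilt_joint_law _ _ V U).
exists C => n v n0 tv; have {}HC := HC n v n0 tv.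
set Z := (fun w => (V w, U w)) in HC *.
set th := INR n * _.
pose W (b : {ffun 'I_n -> Om}) := \prod_(k : 'I_n) tilt V U (v k) (b k).
pose Ty (b : {ffun 'I_n -> Om}) := typ (2 * eps) Z (fun k => (v k, U (b k))).
have W1 : \sum_(b : {ffun 'I_n -> Om}) W b = 1.
  rewrite /W (sum_prod (fun k => tilt V U (v k))) big1 // => k _; apply: tilt_sum.
  exact: (typ_pos q0 k tv).
have W2 : 1 - C / INR n <= \sum_(b : {ffun 'I_n -> Om}) W b * ind (Ty b).
  have -> : \sum_(b : {ffun 'I_n -> Om}) W b * ind (Ty b) =
     \sum_(b : {ffun 'I_n -> Om}) W b - \sum_(b : {ffun 'I_n -> Om}) W b * ind (~ Ty b).
    by rewrite -sumB; apply: eq_bigr => b _; rewrite ind_not; lra.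
  have HC' : \sum_(b : {ffun 'I_n -> Om}) W b * ind (~ Ty b) <= C / INR n by exact: HC.
  rewrite W1; lra.
apply: Rle_trans (Rmult_le_compat_r _ _ _ (Rlt_le _ _ (exp_pos _)) W2) _.
rewrite mul_suml; apply: sum_le => b _.
have [ty|nty] := excluded_middle_informative (Ty b); last first.
  rewrite (ind0 nty); have := wordp_ge0 b;
    have := ind_01 (typ (2 * eps) Z (fun k => (v k, U (b k)))) => -[? ?] ?; nra.
rewrite /Ty in ty; rewrite !ind1 // !Rmult_1_r.
have tyV : typ (2 * eps) V v by apply: typ_map ty; [move=> w; exact: (erefl (Z w).1)|].
have tyU : typ (2 * eps) U (fun k => U (b k)).
  by apply: (typ_map (h := snd)) ty.
have -> : W b = wordp b *
  exp (\sum_(k : 'I_n) (nlp V (v k) + nlp U (U (b k)) - nlp Z (v k, U (b k)))).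
  rewrite /W /wordp -prod_exp -big_split /=; apply: eq_bigr => k _; rewrite /tilt; congr (_ * _).
  rewrite -/Z (prob_exp (typ_pos q0 k ty)) (prob_exp (typ_pos q0 k tyV)) (prob_exp (typ_pos q0 k
    tyU)).
  rewrite /Rdiv -exp_plus -exp_Ropp -exp_plus; congr exp;  set a := surprisal _ _ (v k, _);
    set b1 := surprisal _ _ (v k); set c := surprisal _ _ _; lra.
rewrite Rmult_assoc -exp_plus -[X in _ <= X]Rmult_1_r -exp_0.
apply: Rmult_le_compat_l; first exact: wordp_ge0.
apply: exp_le; rewrite sumB big_split /=.
have [B1 _] := abs_bounds (typ_surprisal q0 q1 ty).
have [_ B2] := abs_bounds (typ_surprisal q0 q1 tyV);
  have [_ B3] := abs_bounds (typ_surprisal q0 q1 tyU).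
rewrite /th /minfo -/Z.
move: B1 B2 B3; set hZ := entropy q Z; set hV := entropy q V; set hU := entropy q U;
  set sV := \sum_(k : 'I_n) nlp V _; set sU := \sum_(k : 'I_n) nlp U _;
set sZ := \sum_(k : 'I_n) nlp Z _. lra.
Qed.

Context {J : finType} (comp : J -> Om -> nat).

(** Coordinates outside [A] read [None], so that subtuples for all [A] share one type. Each [j]
    reads its own outcome [us j], because different codebooks supply different words over [Om]. *)
Definition cA (A : {set J}) (us : J -> Om) : {ffun J -> option nat} :=
  [ffun j => if j \in A then Some (comp j (us j)) else None].

Definition cU (A : {set J}) (w : Om) := cA A (fun _ => w).

Definition bookp (I : finType) (n : nat) (cb : {ffun I -> {ffun 'I_n -> Om}}) : R :=
  \prod_(i : I) wordp (cb i).

Lemma bookp_ge0 (I : finType) n cb : 0 <= @bookp I n cb.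
Proof. by apply: prod_ge0 => i _; apply: wordp_ge0. Qed.

Lemma bookp_sum (I : finType) n : \sum_(cb : {ffun I -> {ffun 'I_n -> Om}}) bookp cb = 1.
Proof. by rewrite /bookp (sum_prod (fun _ => @wordp n)) big1 // => k _; rewrite wordp_sum. Qed.

(* On typical words the tilted weight is at least the inverse of the bound, so
   a change of measure replaces the count of jointly typical words. *)
Lemma tilt_upper (I : finType) (S : eqType) (V : Om -> S) (A : {set J}) (iota : J -> I)
    (n : nat) (eps : R) (v : 'I_n -> S) :
  {in A &, injective iota} ->
  \sum_(cb : {ffun I -> {ffun 'I_n -> Om}}) bookp cb *
    ind (typ eps (fun w => (cU A w, V w)) (fun k => (cA A (fun j => cb (iota j) k), v k))) <=
  exp (- (INR n * (\sum_(j in A) H (comp j) + H V - H (fun w => (cU A w, V w)) -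
     eps * (\sum_(j in A) H (comp j) + H V + H (fun w => (cU A w, V w)))))).
Proof.
move=> inj; set Z := (fun w => (cU A w, V w)); set th := INR n * _.
(* [G k] is the law of an outcome given [V = v k], and [h j w] is the density that conditions
   [comp j] to agree with [w]. Conditioning on a null event gives 0, so the masses are at most 1
   rather than equal to 1. *)
pose G k w := q w * ind (V w = v k) / pr V (v k).
pose h j w w' := ind (comp j w' = comp j w) / pr (comp j) (comp j w).
have inv0 x : 0 <= x -> 0 <= / x.
  move=> x0; have [->|nx] := Req_dec x 0; first by rewrite Rinv_0; lra.
  by left; apply: Rinv_0_lt_compat; lra.
have h0 j w w' : 0 <= h j w w'.
  by apply: Rmult_le_pos; [case: (ind_01 (comp j w' = comp j w))|apply: inv0; apply: prob_ge0].
have G0 k w : 0 <= G k w.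
  apply: Rmult_le_pos; last by apply: inv0; apply: prob_ge0.
  by apply: Rmult_le_pos => //; case: (ind_01 (V w = v k)).
have G1 k : \sum_(w : Om) G k w <= 1.
  rewrite /G /Rdiv -mul_suml -[\sum_(w : Om) _](prob_esp q V (v k)).
  have [->|nx] := Req_dec (pr V (v k)) 0; first by rewrite Rmult_0_l; lra.
  by rewrite Rinv_r //; lra.
have h1 j w : \sum_(w' : Om) q w' * h j w w' <= 1.
  rewrite /h /Rdiv; under eq_bigr => w' _ do rewrite -Rmult_assoc.
  rewrite -mul_suml -[\sum_(w' : Om) _](prob_esp q (comp j) (comp j w)).
  have [->|nx] := Req_dec (pr (comp j) (comp j w)) 0; first by rewrite Rmult_0_l; lra.
  by rewrite Rinv_r //; lra.
(* The tilted density at letter [k], as a mixture over a hidden outcome [w]: for fixed [w] it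
   factors over the codewords, while summing [w] out gives the ratio of probabilities that
   typicality evaluates. *)
pose r (cb : {ffun I -> {ffun 'I_n -> Om}}) k :=
  \sum_(w : Om) G k w * \prod_(j in A) h j w (cb (iota j) k).
suff key : \sum_(cb : {ffun I -> {ffun 'I_n -> Om}}) bookp cb * \prod_(k : 'I_n) r cb k <= 1.
  rewrite -[X in _ <= X]Rmult_1_r.
  apply: Rle_trans (Rmult_le_compat_l _ _ _ (Rlt_le _ _ (exp_pos _)) key).
  rewrite mul_sumr; apply: sum_le => cb _.
  set z := (X in typ eps Z X).
  have r0 : 0 <= \prod_(k : 'I_n) r cb k.
    apply: prod_ge0 => k _; apply: sum_ge0 => w _; apply: Rmult_le_pos => //.
    exact: prod_ge0.
  have [ty|nty] := excluded_middle_informative (typ eps Z z); last first.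
    rewrite (ind0 nty) Rmult_0_r; apply: Rmult_le_pos; first exact: Rlt_le (exp_pos _).
    by apply: Rmult_le_pos => //; apply: bookp_ge0.
  rewrite ind1 // -Rmult_assoc (Rmult_comm (exp _)) Rmult_assoc.
  apply: Rmult_le_compat_l; first exact: bookp_ge0.
  have tyV : typ eps V v by apply: (typ_map (h := snd)) ty.
  have tyj j : j \in A -> typ eps (comp j) (fun k => comp j (cb (iota j) k)).
    move=> jA; apply: (typ_map (h := fun s : {ffun J ->
      option nat} * S => odflt 0%nat (s.1 j))) ty => [w|k].
      by rewrite /= ffunE jA.
    by rewrite /= ffunE jA.
  have -> : \prod_(k : 'I_n) r cb k = exp (\sum_(k : 'I_n)
      (nlp V (v k) + \sum_(j in A) nlp (comp j) (comp j (cb (iota j) k)) - nlp Z (z k))).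
    rewrite -prod_exp; apply: eq_bigr => k _.
    have -> : r cb k = pr Z (z k) / (pr V (v k) *
      \prod_(j in A) pr (comp j) (comp j (cb (iota j) k))).
      rewrite /r prob_esp /esp /Rdiv mul_suml; apply: eq_bigr => w _.
      rewrite /G Rinv_mult /z /Z.
      have -> : ind ((cU A w, V w) = (cA A (fun j => cb (iota j) k), v k)) =
          ind (V w = v k) * \prod_(j in A) ind (comp j (cb (iota j) k) = comp j w).
        have [e|ne] := excluded_middle_informative (V w = v k); last first.
          by rewrite (ind0 ne) Rmult_0_l ind0 // => -[].
        rewrite (ind1 e) Rmult_1_l.
        have [e'|ne'] := excluded_middle_informative (forall j, j \in A ->
          comp j (cb (iota j) k) = comp j w).
          rewrite ind1; last first.
            by congr pair => //; apply/ffunP => j; rewrite !ffunE; case: ifP => // jA; rewrite e'.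
          by rewrite big1 // => j jA; rewrite ind1 // e'.
        rewrite ind0; last first.
          move=> -[/ffunP e2 _]; apply: ne' => j jA; move: (e2 j); rewrite !ffunE jA.
          by case.
        have [j hj] : exists j, ~ (j \in A -> comp j (cb (iota j) k) = comp j w).
          apply: Classical_Prop.NNPP => hh; apply: ne' => j; apply: Classical_Prop.NNPP => hj.
          by apply: hh; exists j.
        have jA : j \in A by apply: Classical_Prop.NNPP => nj; apply: hj.
        rewrite (bigD1 j) //= ind0 ?Rmult_0_l // => e3; exact: hj.
      have -> : \prod_(j in A) h j w (cb (iota j) k) =
         \prod_(j in A) ind (comp j (cb (iota j) k) = comp j w) *
         / \prod_(j in A) pr (comp j) (comp j (cb (iota j) k)).
        rewrite (big_morph Rinv Rinv_mult Rinv_1) -big_split /=; apply: eq_bigr => j jA; rewrite /h.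
        have [e|ne] := excluded_middle_informative (comp j (cb (iota j) k) = comp j w).
          by rewrite e.
        by rewrite (ind0 ne) /Rdiv !Rmult_0_l.
      rewrite /Rdiv; lra.
    rewrite (prob_exp (typ_pos q0 k ty)) (prob_exp (typ_pos q0 k tyV)).
    have -> : \prod_(j in A) pr (comp j) (comp j (cb (iota j) k)) =
        exp (- \sum_(j in A) nlp (comp j) (comp j (cb (iota j) k))).
      rewrite -sumN -prod_exp; apply: eq_bigr => j jA.
      exact: (prob_exp (typ_pos q0 k (tyj j jA))).
    rewrite /Rdiv -exp_plus -exp_Ropp -exp_plus; congr exp.
    by set a := surprisal _ Z _; set b1 := surprisal _ V _; set c := \sum_(j in A) _; lra.
  rewrite -exp_plus -exp_0; apply: exp_le.
  rewrite sumB big_split /= exchange_big /=.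
  have /abs_bounds B1 := typ_surprisal q0 q1 ty; have /abs_bounds B2 := typ_surprisal q0 q1 tyV.
  have B3 : INR n * \sum_(j in A) H (comp j) - eps * (INR n * \sum_(j in A) H (comp j)) <=
      \sum_(j in A) \sum_(k : 'I_n) nlp (comp j) (comp j (cb (iota j) k)).
    rewrite !mul_sumr -sumB; apply: sum_le => j jA.
    by have /abs_bounds[] := typ_surprisal q0 q1 (tyj j jA).
  rewrite /th; move: B1 B2 B3; set hZ := entropy q Z; set hV := entropy q V;
    set hA := \sum_(j in A) H _.
  set sZ := \sum_(k : 'I_n) nlp Z _; set sV := \sum_(k : 'I_n) nlp V _.
  set sA := \sum_(j in A) \sum_(k : 'I_n) _.
  move=> [_ ?] [? _] ?; lra.
pose Hj j (w : {ffun 'I_n -> Om}) (b : {ffun 'I_n -> Om}) := \prod_(k : 'I_n) h j (w k) (b k).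
(* Drawing the whole hidden word first makes the codewords separate, and each density then
   integrates to at most 1. *)
have -> : \sum_(cb : {ffun I -> {ffun 'I_n -> Om}}) bookp cb * \prod_(k : 'I_n) r cb k =
  \sum_(w : {ffun 'I_n -> Om}) \prod_(k : 'I_n) G k (w k) *
    \sum_(cb : {ffun I -> {ffun 'I_n -> Om}}) bookp cb * \prod_(j in A) Hj j w (cb (iota j)).
  under [RHS]eq_bigr => w _ do rewrite mul_sumr.
  rewrite exchange_big /=; apply: eq_bigr => cb _.
  rewrite /r -(sum_prod (fun k w => G k w * \prod_(j in A) h j w (cb (iota j) k))) mul_sumr.
  apply: eq_bigr => w _; rewrite big_split /= /Hj [\prod_(j in A) _]exchange_big /=; lra.
apply: (@Rle_trans _ (\sum_(w : {ffun 'I_n -> Om}) \prod_(k : 'I_n) G k (w k))).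
  apply: sum_le => w _; rewrite -[X in _ <= X]Rmult_1_r; apply: Rmult_le_compat_l.
    exact: prod_ge0.
  rewrite /bookp (@marginal_prod _ _ _ (fun _ => @wordp n) A iota (fun j => Hj j w)) //.
    apply: prod_le1 => j jA; split.
      by apply: sum_ge0 => b _; apply: Rmult_le_pos; [exact: wordp_ge0|apply: prod_ge0].
    rewrite /wordp /Hj; under eq_bigr => b _ do rewrite -big_split /=.
    rewrite (sum_prod (fun k w' => q w' * h j (w k) w')); apply: prod_le1 => k _; split => //.
    by apply: sum_ge0 => w' _; apply: Rmult_le_pos.
  by move=> _; apply: wordp_sum.
rewrite (sum_prod G); apply: prod_le1 => k _; split => //.
by apply: sum_ge0.
Qed.
End Tilting.

(** * Covering and packing *)

Definition ev (P : nat -> Prop) : Prop :=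
  exists N : nat, forall n : nat, (N <= n)%nat -> (1 <= n)%nat -> P n.

Lemma ev_imp (P Q : nat -> Prop) : (forall n, (1 <= n)%nat -> P n -> Q n) -> ev P -> ev Q.
Proof. by move=> h [N HN]; exists N => n Nn n1; apply: h => //; apply: HN. Qed.

Lemma ev_and (P Q : nat -> Prop) : ev P -> ev Q -> ev (fun n => P n /\ Q n).
Proof.
move=> [N HN] [M HM]; exists (maxn N M) => n; rewrite geq_max => /andP[? ?] ?.
by split; [apply: HN|apply: HM].
Qed.

Lemma ev_forall (I : finType) (P : I -> nat -> Prop) :
  (forall i, ev (P i)) -> ev (fun n => forall i, P i n).
Proof.
move=> h; pose N i := proj1_sig (constructive_indefinite_description _ (h i)).
exists (\max_(i : I) N i)%nat => n Nn n1 i.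
apply: (proj2_sig (constructive_indefinite_description _ (h i))) => //.
by apply: leq_trans Nn; apply: leq_bigmax.
Qed.

Lemma ev_ge (r : R) : ev (fun n => r <= INR n).
Proof.
have [N HN] := INR_unbounded r; exists N => n Nn _.
by have /leP/le_INR := Nn; lra.
Qed.

Lemma ev_div (C eta : R) : 0 < eta -> ev (fun n => C / INR n <= eta).
Proof.
move=> eta0; apply: ev_imp (ev_ge (C / eta)) => n n1 h.
have nR : 0 < INR n by apply: lt_0_INR; apply/ltP.
apply: (Rmult_le_reg_r (INR n)) => //; rewrite /Rdiv Rmult_assoc Rinv_l ?Rmult_1_r; last lra.
have := Rmult_le_compat_l eta _ _ (Rlt_le _ _ eta0) h.
by have -> : eta * (C / eta) = C by field; lra.
Qed.

Lemma ev_exp (g eta : R) : 0 < g -> 0 < eta -> ev (fun n => exp (- (INR n * g)) <= eta).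
Proof.
move=> g0 eta0; apply: ev_imp (ev_ge (- ln eta / g)) => n n1 h.
rewrite -[X in _ <= X]exp_ln //; apply: exp_le.
have := Rmult_le_compat_r g _ _ (Rlt_le _ _ g0) h.
have -> : - ln eta / g * g = - ln eta by field; lra.
lra.
Qed.

Lemma sum_ind (B : finType) (P : pred B) : \sum_(b : B) ind (P b) = INR #|P|.
Proof.
transitivity (\sum_(b : B | P b) 1).
  by rewrite [RHS]big_mkcond; apply: eq_bigr => b _; case: ifP => h;
    [rewrite ind1|rewrite ind0 // h].
by rewrite sum_const Rmult_1_r -sum1_count sum1_card.
Qed.

Section Codebook.
Context {Om : finType} (q : Om -> R).
Context (q0 : forall w, 0 <= q w) (q1 : \sum_(w : Om) q w = 1).
Context {K : nat} (comp : 'I_K -> Om -> nat) {X : eqType} (Xr : Om -> X).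

Notation H := (entropy q).
Notation typ := (typ q).
Notation book B n := ({ffun 'I_K * B -> {ffun 'I_n -> Om}}) (only parsing).
Notation cA := (cA comp).
Notation cU := (cU comp).

(* A codeword is a whole word over [Om] drawn from [q], of which only the [j]-th
   component is used by codebook [j]: all codebooks then live in one type. *)
Definition sel (B : finType) n (cb : book B n) (a : {ffun 'I_K -> B}) (k : 'I_n) (j : 'I_K) : Om :=
  cb (j, a j) k.

Definition Ul (j : nat) : {set 'I_K} := [set i : 'I_K | (i < j)%nat].

Definition st (j : nat) (w : Om) := (Xr w, cU (Ul j) w).

Definition covered (B : finType) n (cand : 'I_K -> pred B) (eps : R) (x : 'I_n -> X) (j : nat)
    (cb : book B n) : Prop :=
  exists a : {ffun 'I_K -> B}, (forall i, cand i (a i)) /\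
    typ eps (st j) (fun k => (x k, cA (Ul j) (sel cb a k))).

Definition Ij (j : 'I_K) := minfo q (st j) (comp j).
(** The entropies that multiply the typicality tolerance in [tilt_lower]. *)
Definition Cj (j : 'I_K) := H (st j) + H (comp j) + H (fun w => (st j w, comp j w)).

(** Codebook [j] is independent of the earlier ones and has more words than the inverse of the
    probability [p] that one word fits, so the chance that all fail is at most exp(- N p), which is
    small. *)
Lemma cover_step (j : 'I_K) (eps delta eta : R) :
  0 < eps -> 0 < eta -> 2 * eps * Cj j < delta ->
  ev (fun n => forall (B : finType) (cand : 'I_K -> pred B) (x : 'I_n -> X),
    exp (INR n * (Ij j + delta)) <= INR #|cand j| ->
    \sum_(cb : book B n) bookp q cb *
      ind (covered cand eps x j cb /\ ~ covered cand (2 * eps) x j.+1 cb) <= eta).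
Proof.
move=> eps0 eta0 hd.
have [C HC] := tilt_lower q0 q1 (st j) (comp j) eps0.
pose g := delta - 2 * eps * Cj j.
have g0 : 0 < / 2 * g by rewrite /g; lra.
apply: ev_imp (ev_and (ev_div C (_ : 0 < / 2)) (ev_exp g0 eta0)); last lra.
move=> n n1 [hC hg] B cand x hcand.
(* Only codebook [j] is resampled. Being covered up to [j] reads earlier codebooks alone, so the
   tuple [a] found there stays fixed while the candidates for [j] are fresh. *)
pose C' (i : 'I_K * B) := i.1 == j.
rewrite (@mix_fubini _ _ (fun _ => wordp q (n := n)) C'); last by move=> i; apply: wordp_sum.
have -> : eta = \sum_(cb : book B n) bookp q cb * eta.
  by rewrite -mul_suml bookp_sum // Rmult_1_l.
apply: sum_le => cb _; apply: Rmult_le_compat_l; first exact: bookp_ge0.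
have selE b a k (i : 'I_K) : (i < j)%nat -> sel (mix C' cb b) a k i = sel cb a k i.
  move=> ij; rewrite /sel ffunE /C' /=; case: eqP => // e; by rewrite e ltnn in ij.
have covE b : covered cand eps x j (mix C' cb b) <-> covered cand eps x j cb.
  split=> -[a [va ta]]; exists a; split=> //; apply: (typ_map (h := fun t => t)) ta => // k.
    by congr pair; apply/ffunP => i; rewrite !ffunE inE; case: ifP => // ij; rewrite selE.
  by congr pair; apply/ffunP => i; rewrite !ffunE inE; case: ifP => // ij; rewrite selE.
have [[a [va ta]]|nc] := excluded_middle_informative (covered cand eps x j cb); last first.
  rewrite big1; first lra.
  by move=> b _; rewrite ind0 ?Rmult_0_r // covE => -[].
pose v k := (x k, cA (Ul j) (sel cb a k)).
pose fail (b : {ffun 'I_n -> Om}) :=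
  ~ typ (2 * eps) (fun w => (st j w, comp j w)) (fun k => (v k, comp j (b k))).
apply: (@Rle_trans _ (\sum_(b : book B n) bookp q b *
    \prod_(i in [set c | cand j c]) ind (fail (b (j, i))))).
  apply: sum_le => b _; apply: Rmult_le_compat_l; first exact: bookp_ge0.
  have [ok|nok] := excluded_middle_informative (forall i, i \in [set c | cand j c] ->
    fail (b (j, i))).
    rewrite [X in _ <= X]big1 => [|i iA];
      first by case: (ind_01 (covered cand eps x j (mix C' cb b) /\ ~ covered cand (2 *
        eps) x j.+1 (mix C' cb b))).
    by rewrite ind1 //; apply: ok.
  rewrite ind0; first by apply: prod_ge0 => i _; case: (ind_01 (fail (b (j, i)))).
  move=> [_ nc]; apply: nok => i; rewrite inE => ci ty; apply: nc.
  exists [ffun i' => if i' == j then i else a i']; split.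
    by move=> i'; rewrite ffunE; case: eqP => // ->.
  apply: (typ_map (h := fun s : (X * {ffun 'I_K -> option nat}) * nat =>
     (s.1.1, [ffun i' => if i' == j then Some s.2 else s.1.2 i']))) ty => [w|k].
    rewrite /st; congr pair; apply/ffunP => i'; rewrite !ffunE !inE ltnS leq_eqVlt.
    by case: (i' =P j) => [->|ne]; rewrite ?eqxx //=; case: eqP => // /val_inj.
  congr pair; apply/ffunP => i'; rewrite !ffunE !inE ltnS leq_eqVlt /sel !ffunE /C' /=.
  by case: (i' =P j) => [->|ne]; rewrite ?eqxx //=; case: eqP => // /val_inj.
rewrite (@marginal_prod _ _ _ (fun _ => wordp q (n := n)) _ (fun i => (j, i)) (fun _ b =>
  ind (fail b))); first last.
- by move=> i1 i2 _ _ [].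
- by move=> _; apply: wordp_sum.
set p := \sum_(b : {ffun 'I_n -> Om}) wordp q b *
     ind (typ (2 * eps) (fun w => (st j w, comp j w)) (fun k => (v k, comp j (b k)))).
have -> : \sum_(b : {ffun 'I_n -> Om}) wordp q b * ind (fail b) = 1 - p.
  rewrite -(wordp_sum q1 n) /p -sumB; apply: eq_bigr => b _; rewrite /fail ind_not; lra.
have hp : / 2 * exp (- (INR n * (Ij j + 2 * eps * Cj j))) <= p.
  apply: Rle_trans (HC n v n1 ta); apply: Rmult_le_compat_r; last lra.
  exact: Rlt_le (exp_pos _).
have p1 : p <= 1.
  rewrite -(wordp_sum q1 n); apply: sum_le => b _; rewrite -[X in _ <= X]Rmult_1_r.
  apply: Rmult_le_compat_l; first exact: wordp_ge0.
  by case: (ind_01 (typ (2 * eps) (fun w => (st j w, comp j w)) (fun k => (v k, comp j (b k))))).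
apply: (@Rle_trans _ (\prod_(i in [set c | cand j c]) exp (- p))).
  apply: prod_le => i _; split; first lra.
  by have := exp_ineq1_le (- p); lra.
rewrite prod_exp; apply: Rle_trans hg; apply: exp_le.
have -> : \sum_(i in [set c | cand j c]) - p = INR #|cand j| * - p.
  rewrite -sum_ind mul_suml big_mkcond; apply: eq_bigr => b _; rewrite inE.
  by case: ifP => h; [rewrite ind1 //; lra|rewrite ind0 ?h //; lra].
(* The right side is at least half of exp(n g); the crude bound exp x >= x is enough. *)
suff : INR n * (/ 2 * g) <= INR #|cand j| * p by lra.
apply: Rle_trans (Rmult_le_compat _ _ _ _ _ _ hcand hp).
- have -> : exp (INR n * (Ij j + delta)) * (/ 2 * exp (- (INR n * (Ij j + 2 * eps * Cj j)))) =
    / 2 * exp (INR n * g).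
    rewrite (Rmult_comm (exp _)) Rmult_assoc -exp_plus /g; congr (_ * exp _); lra.
  by have := exp_ineq1_le (INR n * g); lra.
- exact: Rlt_le (exp_pos _).
- by have := exp_pos (- (INR n * (Ij j + 2 * eps * Cj j))); lra.
Qed.

(** Union bound over the first codebook at which covering breaks. Each codebook doubles the
    tolerance, whence the factor [2 ^ K]. *)
Lemma cover (eps delta eta : R) :
  0 < eps -> 0 < eta -> (forall j, 2 ^ K * eps * Cj j < delta) ->
  ev (fun n => forall (B : finType) (cand : 'I_K -> pred B) (x : 'I_n -> X),
    (forall j, exp (INR n * (Ij j + delta)) <= INR #|cand j|) -> typ eps Xr x ->
    \sum_(cb : book B n) bookp q cb *
      ind (~ covered cand (2 ^ K * eps) x K cb) <= eta).
Proof.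
move=> eps0 eta0 hd.
suff main j : (j <= K)%nat -> forall eta, 0 < eta ->
    ev (fun n => forall (B : finType) (cand : 'I_K -> pred B) (x : 'I_n -> X),
    (forall j, exp (INR n * (Ij j + delta)) <= INR #|cand j|) -> typ eps Xr x ->
    \sum_(cb : book B n) bookp q cb *
      ind (~ covered cand (2 ^ j * eps) x j cb) <= eta) by apply: main.
elim: j => [_ |j IH jK] {}eta {}eta0.
  (* Before any codebook only candidates need to exist, and the lower bound on their number is
     positive. *)
  exists 0%nat => n _ n1 B cand x hcand tx.
  rewrite big1; first lra.
  move=> cb _; rewrite ind0 ?Rmult_0_r // => nc; apply: nc.
  have hc (j : 'I_K) : exists b, cand j b.
    have [b cb'|none] := pickP (cand j); first by exists b.
    by have := hcand j; rewrite (eq_card0 none) /=; have := exp_pos (INR n * (Ij j + delta)); lra.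
  pose a := [ffun j => proj1_sig (constructive_indefinite_description _ (hc j))].
  exists a; split.
    by move=> j; rewrite ffunE; exact: (proj2_sig (constructive_indefinite_description _ (hc j))).
  rewrite /= Rmult_1_l; apply: (typ_map (h := fun s => (s, [ffun => None]))) tx => [w|k].
    by congr pair; apply/ffunP => i; rewrite !ffunE inE ltn0.
  by congr pair; apply/ffunP => i; rewrite !ffunE inE ltn0.
have eps'0 : 0 < 2 ^ j * eps by apply: Rmult_lt_0_compat => //; apply: pow_lt; lra.
have Cj0 : 0 <= Cj (Ordinal jK).
  by rewrite /Cj; have := entropy_ge0 q0 q1 (st (Ordinal jK));
    have := entropy_ge0 q0 q1 (comp (Ordinal jK));
    have := entropy_ge0 q0 q1 (fun w => (st (Ordinal jK) w, comp (Ordinal jK) w)); lra.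
have hd' : 2 * (2 ^ j * eps) * Cj (Ordinal jK) < delta.
  apply: Rle_lt_trans (hd (Ordinal jK)); apply: Rmult_le_compat_r => //.
  rewrite -Rmult_assoc -[2 * 2 ^ j]/(2 ^ j.+1); apply: Rmult_le_compat_r; first lra.
  by apply: Rle_pow; [lra|apply/leP].
have eta20 : 0 < eta / 2 by lra.
apply: ev_imp (ev_and (IH (ltnW jK) _ eta20) (cover_step eps'0 eta20 hd')).
move=> n n1 [h1 h2] B cand x hcand tx.
have {}h1 := h1 B cand x hcand tx; have {}h2 := h2 B cand x (hcand (Ordinal jK)).
apply: Rle_trans (_ : eta / 2 + eta / 2 <= _); last lra.
apply: Rle_trans (Rplus_le_compat _ _ _ _ h1 h2).
rewrite -big_split /=; apply: sum_le => cb _; rewrite -Rmult_plus_distr_l.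
apply: Rmult_le_compat_l; first exact: bookp_ge0.
apply: Rle_trans (ind_or _ _); apply: ind_le => nc.
rewrite -[2 * 2 ^ j]/(2 ^ j.+1) /= Rmult_assoc in nc.
by case: (excluded_middle_informative (covered cand (2 ^ j * eps) x j cb)); [right|left].
Qed.

(* [a] stands for the indices sent by any encoder; it is not tied to the actual
   choice, which is what makes a union bound over all [a] possible. *)
Definition confusable (Bi Si : finType) (Yt : Type) (Yr : Om -> Yt) (A Ds : {set 'I_K})
    (n : nat) (eps : R) (cb1 : 'I_K -> pred Bi) (cs : 'I_K -> pred Si) (x : 'I_n -> X) (y : 'I_n ->
      Yt)
    (cb : book (Bi * Si)%type n) : Prop :=
  exists (a : {ffun 'I_K -> Bi * Si}) (s : {ffun 'I_K -> Si}),
    (forall j, cb1 j (a j).1 /\ cs j (a j).2) /\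
    (forall j, if j \in A then cs j (s j) && (s j != (a j).2) else s j == (a j).2) /\
    typ eps (fun w => (cU setT w, Xr w)) (fun k => (cA setT (sel cb a k), x k)) /\
    typ eps (fun w => (cU Ds w, Yr w))
       (fun k => (cA Ds (sel cb [ffun j => ((a j).1, s j)] k), y k)).

(** The factors are the number of tuples, the number of alternatives inside the bins that differ
    exactly on [A], the probability that a tuple is typical with the source word, and the
    probability that fresh words on [A] are typical with the remaining words and the side
    information. *)
Lemma packing (Bi Si : finType) (Yt : eqType) (Yr : Om -> Yt) (A Ds : {set 'I_K})
    (n : nat) (eps : R) (cb1 : 'I_K -> pred Bi) (cs : 'I_K -> pred Si) (x : 'I_n -> X) (y : 'I_n ->
      Yt) :
  A \subset Ds ->
  let V := fun w => (cU (Ds :\: A) w, Yr w) in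
  \sum_(cb : book (Bi * Si)%type n) bookp q cb * ind (confusable Yr A Ds eps cb1 cs x y cb)
  <= (\prod_(j : 'I_K) (INR #|cb1 j| * INR #|cs j|)) * (\prod_(j in A) (INR #|cs j| - 1)) *
    (exp (- (INR n * (\sum_(j : 'I_K) H (comp j) + H Xr - H (fun w => (cU setT w, Xr w)) -
       eps * (\sum_(j : 'I_K) H (comp j) + H Xr + H (fun w => (cU setT w, Xr w)))))) *
     exp (- (INR n * (\sum_(j in A) H (comp j) + H V - H (fun w => (cU A w, V w)) -
       eps * (\sum_(j in A) H (comp j) + H V + H (fun w => (cU A w, V w))))))).
Proof.
move=> AD V.
set e1 := exp (- (INR n * (_ + H Xr - _ - _))); set e2 := exp (- (INR n * (_ + H V - _ - _))).
have e10 : 0 < e1 by apply: exp_pos.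
have e20 : 0 < e2 by apply: exp_pos.
pose T1 (cb : book (Bi * Si)%type n) a := typ eps (fun w => (cU setT w, Xr w)) (fun k =>
  (cA setT (sel cb a k), x k)).
pose T2 (cb : book (Bi * Si)%type n) a := typ eps (fun w => (cU Ds w, Yr w)) (fun k =>
  (cA Ds (sel cb a k), y k)).
pose up (a : {ffun 'I_K -> Bi * Si}) (s : {ffun 'I_K -> Si}) := [ffun j => ((a j).1, s j)].
pose val (a : {ffun 'I_K -> Bi * Si}) j := cb1 j (a j).1 /\ cs j (a j).2.
pose okj (a : {ffun 'I_K ->
  Bi * Si}) j s := if j \in A then cs j s && (s != (a j).2) else s == (a j).2.
have pair_bound a (s : {ffun 'I_K -> Si}) : (forall j, okj a j (s j)) ->
   \sum_(cb : book (Bi * Si)%type n) bookp q cb * (ind (T1 cb a) * ind (T2 cb (up a s))) <= e1 * e2.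
  (* [C] marks the alternative words on [A]. None of them occurs in the tuple [a], so resampling
     them leaves the first typicality event untouched and makes the second one a question about
     fresh words. *)
  move=> ok; pose C (i : 'I_K * (Bi * Si)) := (i.1 \in A) && (i.2 == up a s i.1).
  have Ca j : C (j, a j) = false.
    rewrite /C /=; case jA : (j \in A) => //=; rewrite ffunE.
    have := ok j; rewrite /okj jA => /andP[_ h].
    by apply/negbTE; apply: contra h; case: (a j) => b t /= /eqP[->].
  rewrite (@mix_fubini _ _ (fun _ => wordp q (n := n)) C); last by move=> i; apply: wordp_sum.
  apply: (@Rle_trans _ (\sum_(cb : book (Bi * Si)%type n) bookp q cb * (ind (T1 cb a) * e2))).
    apply: sum_le => cb _; apply: Rmult_le_compat_l; first exact: bookp_ge0.
    have inj : {in A &, injective (fun j => (j, up a s j))} by move=> ? ? _ _ [].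
    have tu := tilt_upper q0 q1 comp V eps (fun k => (cA (Ds :\: A) (sel cb (up a s) k), y k)) inj.
    apply: (Rle_trans _ _ _ _ (Rmult_le_compat_l _ _ _ (proj1 (ind_01 (T1 cb a))) tu)).
    rewrite mul_sumr; apply: sum_le => b _.
    rewrite -[X in _ <= X]Rmult_assoc (Rmult_comm (ind (T1 cb a)) (bookp q b)) [X in _ <=
      X]Rmult_assoc.
    apply: Rmult_le_compat_l; first exact: bookp_ge0.
    rewrite -!ind_and; apply: ind_le => -[t1 t2]; split.
      apply: (typ_map (h := fun t => t)) t1 => // k; congr pair; apply/ffunP => j.
      by rewrite !ffunE in_setT /sel ffunE Ca.
    apply: (typ_map (h := fun t : {ffun 'I_K -> option nat} * Yt =>
      ([ffun j => if j \in A then t.1 j else None],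
       ([ffun j => if j \in Ds :\: A then t.1 j else None], t.2)))) t2 => [w|k].
      rewrite /V; congr (_, (_, _)); apply/ffunP => j; rewrite !ffunE //.
        by case: ifP => // jA; rewrite (subsetP AD _ jA).
      by rewrite inE; case: ifP => // /andP[_ ->].
    congr (_, (_, _)); apply/ffunP => j; rewrite !ffunE //=.
      case: ifP => // jA; rewrite (subsetP AD _ jA) /sel ffunE /C /= jA ffunE eqxx //.
    rewrite inE; case: ifP => // /andP[nA ->]; rewrite /sel /mix !ffunE /C /= (negbTE nA) //.
  have -> : \sum_(cb : book (Bi * Si)%type n) bookp q cb * (ind (T1 cb a) * e2) =
     (\sum_(cb : book (Bi * Si)%type n) bookp q cb * ind (T1 cb a)) * e2.
    by rewrite mul_suml; apply: eq_bigr => cb _; lra.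
  apply: Rmult_le_compat_r; first lra.
  have := tilt_upper q0 q1 comp Xr eps x (_ : {in setT &, injective (fun j => (j, a j))}).
  have allT (F : 'I_K -> R) : \sum_(j in [set: 'I_K]) F j = \sum_(j : 'I_K) F j by apply: eq_bigl
    => j; rewrite inE.
  by rewrite allT; apply; move=> ? ? _ _ [].
(* Union bound over all admissible pairs of tuple and alternative. *)
apply: (@Rle_trans _ (\sum_(a : {ffun 'I_K -> Bi * Si}) \sum_(s : {ffun 'I_K -> Si})
   (ind (forall j, val a j) * ind (forall j, okj a j (s j))) * (e1 * e2))).
  apply: (@Rle_trans _ (\sum_(cb : book (Bi * Si)%type n) \sum_(a : {ffun 'I_K ->
    Bi * Si}) \sum_(s : {ffun 'I_K -> Si})
     (ind (forall j, val a j) * ind (forall j, okj a j (s j))) * (bookp q cb * (ind (T1 cb a) *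
       ind (T2 cb (up a s)))))).
    apply: sum_le => cb _.
    apply: Rle_trans (Rmult_le_compat_l _ _ _ (bookp_ge0 q0 cb) (ind_exists _)) _.
    rewrite mul_sumr; apply: sum_le => a _.
    apply: Rle_trans (Rmult_le_compat_l _ _ _ (bookp_ge0 q0 cb) (ind_exists _)) _.
    rewrite mul_sumr; apply: sum_le => s _.
    by rewrite !ind_and /val /okj /T1 /T2 /up; right; lra.
  rewrite exchange_big /=; apply: sum_le => a _; rewrite exchange_big /=; apply: sum_le => s _.
  rewrite -mul_sumr.
  have [ok|nok] := excluded_middle_informative (forall j, okj a j (s j)); last first.
    by rewrite (ind0 nok) Rmult_0_r !Rmult_0_l; lra.
  apply: Rmult_le_compat_l; last exact: pair_bound.
  by rewrite -ind_and; case: (ind_01 ((forall j, val a j) /\ (forall j, okj a j (s j)))).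
rewrite (eq_bigr (fun a => (ind (forall j, val a j) *
    \sum_(s : {ffun 'I_K -> Si}) ind (forall j, okj a j (s j))) * (e1 * e2))); last first.
  by move=> a _; rewrite mul_sumr mul_suml.
rewrite -mul_suml; apply: Rmult_le_compat_r; first nra.
(* Off [A] the index is forced; on [A] the tuple's own word is excluded. The resulting [- 1]
   matters: a bin with a single word contributes 0 and allows no confusion. *)
have sumS a : (forall j, val a j) -> \sum_(s : {ffun 'I_K -> Si}) ind (forall j, okj a j (s j)) =
    \prod_(j in A) (INR #|cs j| - 1).
  move=> va; rewrite (eq_bigr (fun s : {ffun 'I_K -> Si} => \prod_(j : 'I_K) ind (okj a j (s j)))).
    2: by move=> s _; apply: ind_forall.
  rewrite (sum_prod (fun j t => ind (okj a j t))) [RHS]big_mkcond /=; apply: eq_bigr => j _.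
  rewrite (sum_ind (okj a j)) /okj; case: ifP => jA.
    have -> : #|cs j| = (#|[pred t | cs j t && (t != (a j).2)]|).+1.
      rewrite (cardD1 (a j).2) [_ \in _](proj2 (va j)) add1n; congr _.+1.
      by apply: eq_card => t; rewrite !inE andbC.
    by rewrite S_INR /Rminus Rplus_assoc Rplus_opp_r Rplus_0_r.
  by rewrite card1.
have -> : \sum_(a : {ffun 'I_K -> Bi * Si}) ind (forall j, val a j) *
     \sum_(s : {ffun 'I_K -> Si}) ind (forall j, okj a j (s j)) =
   (\sum_(a : {ffun 'I_K -> Bi * Si}) ind (forall j, val a j)) * \prod_(j in A) (INR #|cs j| - 1).
  rewrite mul_suml; apply: eq_bigr => a _.
  have [va|nva] := excluded_middle_informative (forall j, val a j); first by rewrite sumS.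
  by rewrite (ind0 nva) !Rmult_0_l.
right; congr (_ * _).
rewrite (eq_bigr (fun a : {ffun 'I_K -> Bi * Si} => \prod_(j : 'I_K) ind (val a j))).
  2: by move=> a _; apply: ind_forall.
rewrite (sum_prod (fun j (t : Bi * Si) => ind (cb1 j t.1 /\ cs j t.2))); apply: eq_bigr => j _.
rewrite -!sum_ind mul_suml; under [RHS]eq_bigr => b _ do rewrite mul_sumr.
rewrite pair_big /=; apply: eq_bigr => -[b s] _ /=; exact: ind_and.
Qed.
End Codebook.

(** * Bin sizes, nonnegativity of information, and the chain rule *)

Lemma telescope_sum (K : nat) (g : nat -> R) :
  \sum_(j : 'I_K) (g j - g j.+1) = g 0%nat - g K.
Proof.
elim: K => [|K IH]; first by rewrite big_ord0; lra.
by rewrite big_ord_recr /= IH; lra.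
Qed.

Lemma nat_floor (x : R) : 0 <= x -> exists k : nat, INR k <= x < INR k.+1.
Proof.
move=> x0; have [u1 u2] := archimed x.
have u0 : (0 < up x)%Z by apply: lt_IZR; lra.
exists (Z.to_nat (up x - 1)); rewrite S_INR INR_IZR_INZ Z2Nat.id; last lia.
by rewrite minus_IZR; lra.
Qed.

(* [N] bins of [B] words. When [Rp <= Delta] each bin is a single word, so that
   [N * B] stays of order [exp (n (I + delta))]. *)
Lemma bin_sizes (n : nat) (I Rp Delta delta : R) :
  0 <= Rp <= I -> 0 <= Delta -> 0 <= delta ->
  exists N B : nat, (0 < N)%nat /\ (0 < B)%nat /\
   exp (INR n * (I + delta)) <= INR N * INR B <= 3 * exp (INR n * (I + delta)) /\
   INR N <= 2 * exp (INR n * (I - Rp + Delta + delta)) /\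
   0 <= INR B - 1 <= exp (INR n * (Rp - Delta)).
Proof.
move=> [Rp0 RpI] D0 d0; have n0 := pos_INR n.
(* Rounding the number of bins up by at most one bin overshoots the number of words by at most
   [b]. *)
have pick_N (b : nat) : (0 < b)%nat -> exists N : nat, (0 < N)%nat /\
    exp (INR n * (I + delta)) <= INR N * INR b <= exp (INR n * (I + delta)) + INR b /\
    INR N <= 1 + exp (INR n * (I + delta)) / INR b.
  move=> b0; have b0' : 0 < INR b by apply: lt_0_INR; apply/ltP.
  have y0 : 0 <= exp (INR n * (I + delta)) / INR b.
    by apply: Rmult_le_pos; [exact: Rlt_le (exp_pos _)|left; exact: Rinv_0_lt_compat].
  have [k [k1 k2]] := nat_floor y0; exists k.+1; split => //.
  have e : exp (INR n * (I + delta)) / INR b * INR b = exp (INR n * (I + delta)) by field; lra.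
  move: k1 k2 y0 e; rewrite S_INR; set y := _ / _ => k1 k2 y0 e; split; last lra.
  by split; rewrite -e; nra.
have e1 : 1 <= exp (INR n * (I + delta)) by rewrite -exp_0; apply: exp_le; nra.
have [le|gt] := Rle_lt_dec Rp Delta.
  have [N [N0 [[h1 h2] h3]]] := pick_N 1%nat isT; exists N, 1%nat; do 2!split => //.
  rewrite INR_1 in h1 h2 h3 *; split; first lra.
  split; last by have := exp_pos (INR n * (Rp - Delta)); lra.
  have := @exp_le (INR n * (I + delta)) (INR n * (I - Rp + Delta + delta)) _;
    rewrite Rdiv_1_r in h3.
  by move=> h; have := h ltac:(nra); lra.
(* The bin size is the successor of this floor, so that the size minus 1 obeys the bound. It is at
   most twice exp(n (I + delta)), which with the overshoot of [pick_N] explains the factor 3. *)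
have [B [B1 B2]] := @nat_floor (exp (INR n * (Rp - Delta))) (Rlt_le _ _ (exp_pos _)).
have [N [N0 [[h1 h2] h3]]] := pick_N B.+1 isT; exists N, B.+1; do 2!split => //.
have E : exp (INR n * (Rp - Delta)) <= exp (INR n * (I + delta)) by apply: exp_le; nra.
move: h2 B2; rewrite S_INR => h2 B2; rewrite S_INR in h1 h3 *.
split; first by lra.
have B0 := pos_INR B; split; last lra.
have h4 : exp (INR n * (I + delta)) / (INR B + 1) <= exp (INR n * (I - Rp + Delta + delta)).
  apply: (Rmult_le_reg_r (INR B + 1)); first lra.
  rewrite /Rdiv Rmult_assoc Rinv_l ?Rmult_1_r; last lra.
  apply: (@Rle_trans _ (exp (INR n * (I - Rp + Delta + delta)) * exp (INR n * (Rp - Delta)))).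
    by rewrite -exp_plus; right; congr exp; lra.
  by apply: Rmult_le_compat_l; [exact: Rlt_le (exp_pos _)|lra].
have e2 : 1 <= exp (INR n * (I - Rp + Delta + delta)) by rewrite -exp_0; apply: exp_le; nra.
lra.
Qed.

Section Information.
Context {Om : finType} (q : Om -> R).
Context (q0 : forall w, 0 <= q w) (q1 : \sum_(w : Om) q w = 1).

(** Gibbs' inequality: with [r] the density of the joint law against the product of the marginals,
    ln r >= 1 - 1/r where [q] is positive, and 1/r has mean at most 1. It makes the truncation of R'
    at the mutual information nonnegative. *)
Lemma minfo_ge0 (S T : eqType) (V : Om -> S) (U : Om -> T) : 0 <= minfo q V U.
Proof.
rewrite /minfo !entropyE /esp; set Z := (fun w => (V w, U w)).
pose r s := prob_of q Z s / (prob_of q V s.1 * prob_of q U s.2).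
have rE w : 0 < q w -> 0 < r (V w, U w) /\
    surprisal q V (V w) + surprisal q U (U w) - surprisal q Z (Z w) = ln (r (V w, U w)).
  move=> qw; have pZ := Rlt_le_trans _ _ _ qw (prob_ge q0 Z w).
  have pV := Rlt_le_trans _ _ _ qw (prob_ge q0 V w);
    have pU := Rlt_le_trans _ _ _ qw (prob_ge q0 U w).
  have pVU := Rmult_lt_0_compat _ _ pV pU.
  split; first by apply: Rmult_lt_0_compat => //; apply: Rinv_0_lt_compat.
  rewrite /r /= ln_mult ?ln_Rinv ?ln_mult /surprisal //; last exact: Rinv_0_lt_compat.
  by set a := ln (prob_of q V _); set b := ln (prob_of q U _); set c := ln (prob_of q Z _); lra.
have r_le : esp q (fun w => / r (V w, U w)) <= 1.
  rewrite (tilt_joint_law q0 V U (fun s => / r s)) -q1; apply: sum_le => w _.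
  rewrite -[X in _ <= X]Rmult_1_r; apply: Rmult_le_compat_l => //.
  rewrite -q1; apply: sum_le => b _; rewrite /tilt -/Z -/(r (V w, U b)) Rmult_assoc.
  rewrite -[X in _ <= X]Rmult_1_r; apply: Rmult_le_compat_l => //.
  have [->|nz] := Req_dec (r (V w, U b)) 0; first by rewrite Rmult_0_l; lra.
  by rewrite Rinv_r //; lra.
rewrite -big_split -sumB /=.
apply: (@Rle_trans _ (\sum_(w : Om) (q w - q w * / r (V w, U w)))).
  by rewrite sumB q1; move: r_le; rewrite /esp; lra.
apply: sum_le => w _.
have [q00|qw] := Rle_lt_dec (q w) 0.
  have -> : q w = 0 by have := q0 w; lra.
  lra.
have [r0 e] := rE w qw.
rewrite -Rmult_plus_distr_l -Rmult_minus_distr_l -/(Z w) e -[X in X - _]Rmult_1_r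
  -Rmult_minus_distr_l.
apply: Rmult_le_compat_l => //.
have := exp_ineq1_le (- ln (r (V w, U w))); rewrite exp_Ropp exp_ln //; rewrite -/(Z w); lra.
Qed.
End Information.

Section Chain.
Context {Om : finType} (q : Om -> R).
Context {K : nat} (comp : 'I_K -> Om -> nat) {X : eqType} (Xr : Om -> X).

(** The covering rates add up to exactly the exponent in [packing] for a full tuple and the source
    word, so the number of tuples and the probability of each cancel up to slack. The sum telescopes
    because the state before [j] together with component [j] is the state before [j.+1]. *)
Lemma chain_rule : \sum_(j : 'I_K) Ij q comp Xr j =
  \sum_(j : 'I_K) entropy q (comp j) + entropy q Xr - entropy q (fun w => (cU comp setT w, Xr w)).
Proof.
pose g j := entropy q (st comp Xr j).
transitivity (\sum_(j : 'I_K) (entropy q (comp j) + (g j - g j.+1))).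
  apply: eq_bigr => j _; rewrite /Ij /minfo /g.
  have -> : entropy q (fun w => (st comp Xr j w, comp j w)) = entropy q (st comp Xr j.+1).
    apply: entropy_recode => w w'; rewrite /st !xpair_eqE -andbA; congr andb.
    apply/andP/eqP => [[/eqP/ffunP e /eqP e']|/ffunP e].
      apply/ffunP => i; rewrite !ffunE !inE ltnS leq_eqVlt; have := e i; rewrite !ffunE !inE.
      by case: (nat_of_ord i =P nat_of_ord j) => [/val_inj ->|//]; rewrite /= e'.
    split; apply/eqP; last by have := e j; rewrite !ffunE !inE ltnS leqnn => -[].
    apply/ffunP => i; have := e i; rewrite !ffunE !inE; case: ifP => [h|h _].
      by case: ifP => // _; rewrite (ltn_trans h).
    case: ifP => // h'.
    by rewrite ltnS (ltnW h') in h.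
  lra.
rewrite big_split /= telescope_sum.
have -> : g 0%nat = entropy q Xr.
  apply: entropy_recode => w w'; rewrite /st xpair_eqE [X in _ && X](_ : _ = true) ?andbT //.
  by apply/eqP/ffunP => i; rewrite !ffunE !inE.
have -> : g K = entropy q (fun w => (cU comp setT w, Xr w)).
  have UlK : Ul K = [set: 'I_K] by apply/setP => i; rewrite !inE ltn_ord.
  by apply: entropy_recode => w w'; rewrite /st UlK !xpair_eqE andbC.
by rewrite /Rminus Rplus_assoc.
Qed.
End Chain.

(** * Random coding for a fixed joint law *)

Lemma sum_zip (I A B : finType) (F : {ffun I -> A * B} -> R) :
  \sum_(w : {ffun I -> A * B}) F w =
  \sum_(x : {ffun I -> A}) \sum_(y : {ffun I -> B}) F [ffun k => (x k, y k)].
Proof.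
rewrite pair_big /=.
rewrite (reindex (fun p : {ffun I -> A} * {ffun I -> B} => [ffun k => (p.1 k, p.2 k)])) //=.
exists (fun w : {ffun I -> A * B} => ([ffun k => (w k).1], [ffun k => (w k).2])).
  by move=> [x y] _ /=; congr pair; apply/ffunP => k; rewrite !ffunE.
by move=> w _; apply/ffunP => k; rewrite !ffunE /=; case: (w k).
Qed.

Lemma average_le (I : finType) (mu f : I -> R) (eta : R) :
  (forall i, 0 <= mu i) -> \sum_(i : I) mu i = 1 -> \sum_(i : I) mu i * f i <= eta ->
  exists i, f i <= eta.
Proof.
move=> mu0 mu1 h; apply: Classical_Prop.NNPP => no.
have gt i : eta < f i by apply: Rnot_le_lt => hi; apply: no; exists i.
have t0 i : 0 <= mu i * (f i - eta) by apply: Rmult_le_pos => //; have := gt i; lra.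
have s0 : \sum_(i : I) mu i * (f i - eta) = 0.
  apply: Rle_antisym; last exact: sum_ge0.
  rewrite (eq_bigr (fun i => mu i * f i - mu i * eta)) => [|i _]; last lra.
  by rewrite sumB -mul_suml mu1; lra.
suff : \sum_(i : I) mu i = 0 by rewrite mu1; lra.
apply: big1 => i _; have := sum_eq0 i t0 s0; have := gt i => gi /Rmult_integral; case => //; lra.
Qed.

Lemma card_below (M k : nat) : (k <= M)%nat -> #|[pred i : 'I_M | (i < k)%nat]| = k.
Proof. by move=> kM; rewrite -sum1_card -(big_ord_widen M (fun _ =>
  1%nat)) // sum1_card card_ord. Qed.

(** The exponents [T] and [S] cancel. What remains is the gain [Delta] from the shortened bins
    against the slack of the codebook sizes and of typicality. *)
Lemma pack_bound (K n : nat) (A : {set 'I_K}) (N B : 'I_K -> R) (Iv Rp : 'I_K -> R)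
    (Delta delta e C1 C2 T S : R) :
  A != set0 -> T = \sum_(j : 'I_K) Iv j -> \sum_(j in A) Rp j <= S ->
  (forall j, 0 <= N j * B j <= 3 * exp (INR n * (Iv j + delta))) ->
  (forall j, 0 <= B j - 1 <= exp (INR n * (Rp j - Delta))) ->
  0 < Delta -> INR K * delta + e * (C1 + C2) <= Delta / 2 ->
  \prod_(j : 'I_K) (N j * B j) * \prod_(j in A) (B j - 1) *
    (exp (- (INR n * (T - e * C1))) * exp (- (INR n * (S - e * C2)))) <=
  3 ^ K * exp (- (INR n * (Delta / 2))).
Proof.
move=> A0 TE RS hNB hB D0 hd; have n0 := pos_INR n.
have h1 : \prod_(j : 'I_K) (N j * B j) <= 3 ^ K * exp (INR n * (T + INR K * delta)).
  apply: Rle_trans (prod_le _ (fun j _ => hNB j)) _; right.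
  rewrite big_split /= prod_exp; congr (_ * exp _).
    by rewrite big_const card_ord; elim: {1 2}K => //= k ->.
  by rewrite -mul_sumr big_split /= sum_constn TE.
have h2 : \prod_(j in A) (B j - 1) <= exp (INR n * (S - Delta)).
  apply: Rle_trans (prod_le _ (fun j _ => hB j)) _.
  rewrite prod_exp -mul_sumr sumB; apply: exp_le; apply: Rmult_le_compat_l => //.
  have [j jA] := set0Pn _ A0.
  (* Nonemptiness of [A] secures at least one full gain [Delta]. *)
  have : Delta <= \sum_(j in A) Delta.
    rewrite (bigD1 j) //= -[X in X <= _]Rplus_0_r; apply: Rplus_le_compat_l.
    by apply: sum_ge0 => *; lra.
  move: RS; set r := \sum_(i in A) Rp i; set dd := \sum_(i in A) Delta; lra.
have p1 : 0 <= \prod_(j : 'I_K) (N j * B j) by apply: prod_ge0 => j _; case: (hNB j).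
have p2 : 0 <= \prod_(j in A) (B j - 1) by apply: prod_ge0 => j _; case: (hB j).
have p3 := Rmult_le_compat _ _ _ _ p1 p2 h1 h2.
rewrite -exp_plus.
apply: Rle_trans (Rmult_le_compat_r _ _ _ (Rlt_le _ _ (exp_pos _)) p3) _.
rewrite !Rmult_assoc -!exp_plus; apply: Rmult_le_compat_l; first by apply: pow_le; lra.
apply: exp_le; nra.
Qed.

Section Setting.
Context (X : finType) (m : nat) (Y : 'I_m -> finType).
Context (c : 'I_(K m) -> nat) (P : X -> Yv m Y -> R) (p : Uv m c -> X -> Yv m Y -> R).
Context (P0 : forall x y, 0 <= P x y) (P1 : \sum_(x : X) \sum_(y : Yv m Y) P x y = 1).
Context (p0 : forall u x y, 0 <= p u x y)
  (pP : forall x y, \sum_(u : Uv m c) p u x y = P x y)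
  (markov : forall u x y,
     p u x y * (\sum_(u' : Uv m c) \sum_(y' : Yv m Y) p u' x y')
     = (\sum_(y' : Yv m Y) p u x y') * (\sum_(u' : Uv m c) p u' x y)).

Definition Omega : finType := ((Uv m c * X) * Yv m Y)%type.
Definition qd : Omega -> R := jointq X m Y c p.
Definition comp (j : 'I_(K m)) (w : Omega) : nat := w.1.1 j.
Definition xr (w : Omega) : X := w.1.2.
Definition yr (l : 'I_m) (w : Omega) : Y l := w.2 l.
Definition asm (us : 'I_(K m) -> Omega) : Uv m c := [ffun j => (us j).1.1 j].

Notation typ := (typ qd).
Notation K := (K m).
Notation book B n := ({ffun 'I_K * B -> {ffun 'I_n -> Omega}}) (only parsing).
Notation source n := ({ffun 'I_n -> X * Yv m Y}) (only parsing).

Lemma cA_asm A us : cA comp A us = UA m c A (asm us).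
Proof. by apply/ffunP => j; rewrite !ffunE. Qed.

Lemma qd_ge0 w : 0 <= qd w. Proof. exact: p0. Qed.

Lemma sum_Omega (G : Omega -> R) :
  \sum_(w : Omega) qd w * G w =
  \sum_(u : Uv m c) \sum_(x : X) \sum_(y : Yv m Y) p u x y * G ((u, x), y).
Proof.
rewrite sum_pair.
rewrite (sum_pair (fun ux : Uv m c * X => \sum_(y : Yv m Y) qd (ux, y) * G (ux, y))).
by [].
Qed.

Lemma sum_Omega_xy (G : X -> Yv m Y -> R) :
  \sum_(w : Omega) qd w * G w.1.2 w.2 = \sum_(x : X) \sum_(y : Yv m Y) P x y * G x y.
Proof.
rewrite (sum_Omega (fun w => G w.1.2 w.2)) /= exchange_big /=; apply: eq_bigr => x _.
rewrite exchange_big /=; apply: eq_bigr => y _.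
by rewrite -mul_suml pP.
Qed.

Lemma qd_sum : \sum_(w : Omega) qd w = 1.
Proof.
transitivity (\sum_(w : Omega) qd w * 1); first by apply: eq_bigr => w _; lra.
rewrite (sum_Omega_xy (fun _ _ => 1)) -[RHS]P1; apply: eq_bigr => x _; apply: eq_bigr => y _; lra.
Qed.

Definition srcp n (w : source n) : R := \prod_(k : 'I_n) P (w k).1 (w k).2.

Lemma srcp_ge0 n w : 0 <= @srcp n w.
Proof. exact: prod_ge0. Qed.

Lemma srcp_sum n : \sum_(w : source n) srcp w = 1.
Proof.
rewrite /srcp (sum_prod (fun _ (b : X * Yv m Y) => P b.1 b.2)) big1 // => k _.
by rewrite (sum_pair (fun b : X * Yv m Y => P b.1 b.2)).
Qed.

(** The case of [cond_typ] with constant condition, where the constant word is typical with no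
    error. *)
Lemma source_typ eps : 0 < eps -> exists C : R, forall n, (0 < n)%nat ->
  \sum_(w : source n) srcp w * ind (~ typ (2 * eps) xr (fun k => (w k).1)) <= C / INR n.
Proof.
move=> eps0.
have [||C HC] := @cond_typ Omega qd qd_ge0 unit X (X * Yv m Y)%type (fun _ => tt) xr
   (fun _ b => P b.1 b.2) (fun _ b => b.1) eps eps0 (fun _ b => P0 b.1 b.2).
- by move=> _ _; rewrite -(pair_big predT predT P).
- move=> F; rewrite /esp -mul_suml qd_sum Rmult_1_l (sum_Omega_xy (fun x _ => F x)).
  by rewrite (sum_pair (fun b : X * Yv m Y => P b.1 b.2 * F b.1)).
exists C => n n0; apply: (HC n (fun _ => tt) n0).
move=> f f0; rewrite sum_constn /esp -mul_suml qd_sum Rmult_1_l Rminus_diag Rabs_R0.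
by apply: Rmult_le_pos; [lra|apply: Rmult_le_pos => //; apply: pos_INR].
Qed.

Definition PX x := \sum_(y : Yv m Y) P x y.
Definition chan x y := P x y / PX x.

Lemma PX_ge0 x : 0 <= PX x. Proof. exact: sum_ge0. Qed.

Lemma chan_ge0 x y : 0 <= chan x y.
Proof.
apply: Rmult_le_pos => //; have := PX_ge0 x; case=> [h|<-]; last by rewrite Rinv_0; lra.
by left; apply: Rinv_0_lt_compat.
Qed.

Lemma chanE x y : P x y = PX x * chan x y.
Proof.
rewrite /chan; have := PX_ge0 x; case=> [h|h].
  rewrite Rmult_comm /Rdiv Rmult_assoc Rinv_l ?Rmult_1_r //; lra.
by rewrite -h Rmult_0_l; apply: (sum_eq0 y (F := P x)).
Qed.

Lemma chan_sum x : 0 < PX x -> \sum_(y : Yv m Y) chan x y = 1.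
Proof. by move=> h; rewrite /chan /Rdiv -mul_suml -/(PX x) Rinv_r //; lra. Qed.

(** The Markov chain in product form; where [PX x] is 0 both sides vanish. *)
Lemma markov_law u x y : p u x y = (\sum_(y' : Yv m Y) p u x y') * chan x y.
Proof.
have E : \sum_(u' : Uv m c) \sum_(y' : Yv m Y) p u' x y' = PX x.
  by rewrite exchange_big; apply: eq_bigr => y' _.
have := markov u x y; rewrite E pP /chan.
have [h M|h _] := PX_ge0 x.
  rewrite /Rdiv -Rmult_assoc -M Rmult_assoc Rinv_r ?Rmult_1_r //; lra.
rewrite -h /Rdiv Rinv_0 Rmult_0_r Rmult_0_r.
have h1 : \sum_(y' : Yv m Y) p u x y' = 0.
  apply: Rle_antisym; last exact: sum_ge0.
  have := sum_term_le u (F := fun u' => \sum_(y' : Yv m Y) p u' x y').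
  by rewrite E -h; apply=> u'; apply: sum_ge0.
exact: (sum_eq0 y (F := p u x)).
Qed.

(** Takes the place of the Markov lemma: given U and X the side informations follow a channel from X
    alone, so [cond_typ] applies to whatever typical words the encoder has picked. *)
Lemma channel_typ eps : 0 < eps -> exists C : R, forall n (v : 'I_n -> Uv m c * X), (0 < n)%nat ->
  typ eps (fun w => w.1) v ->
  \sum_(y : {ffun 'I_n -> Yv m Y}) \prod_(k : 'I_n) chan (v k).2 (y k) *
     ind (~ typ (2 * eps) (fun w => w) (fun k => (v k, y k))) <= C / INR n.
Proof.
move=> eps0.
apply: (@cond_typ Omega qd qd_ge0 (Uv m c * X)%type Omega (Yv m Y) (fun w => w.1) (fun w => w)
   (fun s y => chan s.2 y) (fun s y => (s, y)) eps eps0 (fun s y => chan_ge0 s.2 y)).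
- move=> s /(prob_gt0 qd_ge0)[w <- qw]; apply: chan_sum.
  apply: (@Rlt_le_trans _ (P w.1.2 w.2)); last exact: (sum_term_le w.2 (F := P w.1.2)).
  apply: Rlt_le_trans qw _; rewrite -pP.
  exact: (sum_term_le w.1.1 (F := fun u => p u w.1.2 w.2)).
- move=> F; rewrite /esp sum_Omega (sum_Omega (fun w =>
  \sum_(b : Yv m Y) chan w.1.2 b * F (w.1, b))) /=.
  apply: eq_bigr => u _; apply: eq_bigr => x _.
  rewrite -mul_suml mul_sumr; apply: eq_bigr => y _.
  by rewrite {1}markov_law Rmult_assoc.
Qed.

Lemma channel_sum n (G : source n -> R) :
  \sum_(w : source n) srcp w * G w =
  \sum_(x : {ffun 'I_n -> X}) \prod_(k : 'I_n) PX (x k) *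
    \sum_(y : {ffun 'I_n -> Yv m Y}) \prod_(k : 'I_n) chan (x k) (y k) * G [ffun k => (x k, y k)].
Proof.
rewrite sum_zip; apply: eq_bigr => x _; rewrite mul_sumr; apply: eq_bigr => y _.
rewrite -Rmult_assoc /srcp -big_split /=; congr (_ * _).
by apply: eq_bigr => k _; rewrite ffunE /= chanE.
Qed.

Lemma PX_sum n : \sum_(x : {ffun 'I_n -> X}) \prod_(k : 'I_n) PX (x k) = 1.
Proof. by rewrite (sum_prod (fun _ => PX)) big1. Qed.

Lemma asm_inj_UA (u u' : Uv m c) : UA m c setT u = UA m c setT u' -> u = u'.
Proof.
move=> /ffunP e; apply/ffunP => j; apply: val_inj.
by have := e j; rewrite !ffunE in_setT => -[].
Qed.

(** For events estimated over random codebooks at each fixed source block; the companion lemma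
    treats events estimated over the source at each fixed codebook. *)
Lemma double_expectation_le_r n (I : finType) (mu : I -> R) (F : I -> source n -> R) b :
  (forall i, 0 <= mu i) -> \sum_(i : I) mu i = 1 ->
  (forall w, \sum_(i : I) mu i * F i w <= b) ->
  \sum_(i : I) mu i * (\sum_(w : source n) srcp w * F i w) <= b.
Proof.
move=> mu0 mu1 h.
apply: (@Rle_trans _ (\sum_(w : source n) srcp w * \sum_(i : I) mu i * F i w)).
  rewrite (eq_bigr (fun i => \sum_(w : source n) srcp w * (mu i * F i w))) => [|i _].
    by rewrite exchange_big /=; right; apply: eq_bigr => w _; rewrite mul_sumr.
  by rewrite mul_sumr; apply: eq_bigr => w _; lra.
apply: (@Rle_trans _ (\sum_(w : source n) srcp w * b)).
  by apply: sum_le => w _; apply: Rmult_le_compat_l; [exact: srcp_ge0|].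
by rewrite -mul_suml srcp_sum; lra.
Qed.

Lemma double_expectation_le_l n (I : finType) (mu : I -> R) (F : I -> source n -> R) b :
  (forall i, 0 <= mu i) -> \sum_(i : I) mu i = 1 ->
  (forall i, \sum_(w : source n) srcp w * F i w <= b) ->
  \sum_(i : I) mu i * (\sum_(w : source n) srcp w * F i w) <= b.
Proof.
move=> mu0 mu1 h; apply: (@Rle_trans _ (\sum_(i : I) mu i * b)).
  by apply: sum_le => i _; apply: Rmult_le_compat_l.
by rewrite -mul_suml mu1; lra.
Qed.

Context (v : 'I_K -> {set 'I_m}) (Rp : 'I_K -> R).
Notation H := (entropy qd).
Notation Ij := (Ij qd comp xr).
Context (Rp_range : forall j, 0 <= Rp j <= Ij j).
Context (Rp_pack : forall (l : 'I_m) (A : {set 'I_K}), A \subset Dl m v l -> A != set0 ->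
  \sum_(j in A) Rp j <= \sum_(j in A) H (comp j) +
    H (fun w => (cU comp (Dl m v l :\: A) w, yr l w)) -
    H (fun w => (cU comp A w, (cU comp (Dl m v l :\: A) w, yr l w)))).

(** The second clause does not mention the encoder [e], so its probability can be averaged over
    codebooks with the source block held fixed. *)
Definition good n (Bi Si : finType) (cb1 : 'I_K -> pred Bi) (cs : 'I_K -> pred Si) (eps : R)
    (cb : book (Bi * Si)%type n) (e : {ffun 'I_n -> X} -> option {ffun 'I_K -> Bi * Si})
    (w : source n) : Prop :=
  (exists a, e [ffun k => (w k).1] = Some a /\
     (forall j, cb1 j (a j).1 /\ cs j (a j).2) /\
     typ eps (fun w => w) (fun k => ((asm (sel cb a k), (w k).1), (w k).2))) /\
  forall (l : 'I_m) (A : {set 'I_K}), A \subset Dl m v l -> A != set0 ->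
     ~ confusable qd comp xr (yr l) A (Dl m v l) eps cb1 cs (fun k => (w k).1) (fun k =>
       (w k).2 l) cb.

Lemma random_coding (Delta tol eta : R) : 0 < Delta -> 0 < tol -> 0 < eta ->
  ev (fun n => exists (Bi Si : finType) (cb1 : 'I_K -> pred Bi) (cs : 'I_K -> pred Si) (eps : R)
    (cb : book (Bi * Si)%type n) (e : {ffun 'I_n -> X} -> option {ffun 'I_K -> Bi * Si}),
    (forall j, (0 < #|cb1 j|)%nat /\ INR #|cb1 j| <= 2 * exp (INR n * (Ij j - Rp j + 2 * Delta))) /\
    0 <= eps <= tol /\
    \sum_(w : source n) srcp w * ind (~ good cb1 cs eps cb e w) <= eta).
Proof.
move=> D0 t0 eta0.
pose T := 2 ^ K; have T0 : 0 < T by apply: pow_lt; lra.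
have K0 := pos_INR K.
(* The excess [delta] of all [K] codebooks plus one more [delta] for typicality errors uses a
   quarter of [Delta]. *)
pose delta := Delta / (4 * (INR K + 1)).
have d0 : 0 < delta by apply: Rdiv_lt_0_compat; lra.
have dE : INR K * delta + delta = Delta / 4 by rewrite /delta; field; lra.
pose Vr (lA : 'I_m * {set 'I_K}) := fun w : Omega => (cU comp (Dl m v lA.1 :\: lA.2) w, yr lA.1 w).
pose C1 := \sum_(j : 'I_K) H (comp j) + H xr + H (fun w => (cU comp setT w, xr w)).
pose C2 (lA : 'I_m * {set 'I_K}) := \sum_(j in lA.2) H (comp j) + H (Vr lA) + H (fun w =>
  (cU comp lA.2 w, Vr lA w)).
have H0 (S : eqType) (Z : Omega -> S) : 0 <= H Z := entropy_ge0 qd_ge0 qd_sum Z.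
have C10 : 0 <= C1.
  rewrite /C1; have := H0 _ xr; have := H0 _ (fun w => (cU comp setT w, xr w)).
  have : 0 <= \sum_(j : 'I_K) H (comp j) by apply: sum_ge0.
  lra.
have C20 lA : 0 <= C2 lA.
  rewrite /C2; have := H0 _ (Vr lA); have := H0 _ (fun w => (cU comp lA.2 w, Vr lA w)).
  have : 0 <= \sum_(j in lA.2) H (comp j) by apply: sum_ge0.
  lra.
have Cj0 j : 0 <= Cj qd comp xr j.
  rewrite /Cj; have := H0 _ (st comp xr j); have := H0 _ (comp j).
  by have := H0 _ (fun w => (st comp xr j w, comp j w)); lra.
pose sC2v := \sum_(lA : 'I_m * {set 'I_K}) C2 lA.
pose sCjv := \sum_(j : 'I_K) Cj qd comp xr j.
(* Dominates every entropy total that multiplies a tolerance, over all codebooks and all pairs of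
   decoder and subset; the 1 keeps it positive. *)
pose Ct := 1 + C1 + sC2v + sCjv.
have sC2 : 0 <= sC2v by apply: sum_ge0.
have sCj : 0 <= sCjv by apply: sum_ge0.
have Ct1 : 1 <= Ct by rewrite /Ct; lra.
pose t := Rmin tol (delta / Ct).
have t_pos : 0 < t by apply: Rmin_glb_lt => //; apply: Rdiv_lt_0_compat; lra.
have t_tol : t <= tol := Rmin_l _ _.
have tCt : t * Ct <= delta.
  apply: Rle_trans (Rmult_le_compat_r Ct _ _ _ (Rmin_r _ _)) _; first lra.
  by right; field; lra.
(* Works backwards from the final tolerance [t]: source typicality costs a factor 2, covering
   [T = 2 ^ K], and the channel another 2. *)
pose e0 := t / (4 * T).
have e0_pos : 0 < e0 by apply: Rdiv_lt_0_compat; lra.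
pose ec := T * (2 * e0); pose ef := 2 * ec.
have efE : ef = t by rewrite /ef /ec /e0; field; lra.
have ec_pos : 0 < ec by rewrite /ef in efE; lra.
have Hcov j : 2 ^ K * (2 * e0) * Cj qd comp xr j < delta.
  rewrite -/T -/ec; have h : Cj qd comp xr j <= sCjv := sum_term_le j Cj0.
  have : Cj qd comp xr j <= Ct by rewrite /Ct; lra.
  by move=> h2; rewrite /ef in efE; nra.
have Hpack lA : INR K * delta + ef * (C1 + C2 lA) <= Delta / 2.
  have h : C2 lA <= sC2v := sum_term_le lA C20.
  have : C1 + C2 lA <= Ct by rewrite /Ct; lra.
  by rewrite efE => h2; nra.
pose Np := INR #|{: 'I_m * {set 'I_K}}|.
have Np0 : 0 <= Np := pos_INR _.
have eta4 : 0 < eta / 4 by lra.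
(* The share of one pair of decoder and subset, divided by the factor [3 ^ K] of [pack_bound]. *)
have etaN : 0 < eta / 4 / (Np + 1) / 3 ^ K.
  by apply: Rdiv_lt_0_compat; [apply: Rdiv_lt_0_compat; lra|apply: pow_lt; lra].
have [Ca HCa] := source_typ e0_pos.
have [Cb HCb] := channel_typ ec_pos.
have e02 : 0 < 2 * e0 by lra.
have D2 : 0 < Delta / 2 by lra.
apply: ev_imp (ev_and (ev_and (ev_div Ca eta4) (ev_div Cb eta4))
  (ev_and (cover qd_ge0 qd_sum e02 eta4 Hcov) (ev_exp D2 etaN))).
move=> n n1 [[ha hb] [hc hd]].
have [N sizesN] := fun_choice (fun j => bin_sizes n (Rp_range j) (Rlt_le _ _ D0) (Rlt_le _ _ d0)).
have [B sizes] := fun_choice sizesN.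
(* One type of bins and one of positions serve all codebooks; [cb1 j] and [cs j] cut out the sizes
   that belong to [j]. *)
pose Bi := 'I_(\max_(j : 'I_K) N j)%nat; pose Si := 'I_(\max_(j : 'I_K) B j)%nat.
pose cb1 (j : 'I_K) : pred Bi := [pred i | (nat_of_ord i < N j)%nat].
pose cs (j : 'I_K) : pred Si := [pred i | (nat_of_ord i < B j)%nat].
have cN j : #|cb1 j| = N j by apply: card_below; apply: leq_bigmax.
have cB j : #|cs j| = B j by apply: card_below; apply: leq_bigmax.
pose cand (j : 'I_K) : pred (Bi * Si) := [pred i | cb1 j i.1 && cs j i.2].
have ccand j : INR #|cand j| = INR (N j) * INR (B j).
  have -> : #|cand j| = (#|cb1 j| * #|cs j|)%nat by rewrite -cardX; apply: eq_card => i;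
    rewrite !inE.
  by rewrite cN cB mult_INR.
pose xs (w : source n) := fun k => (w k).1.
pose isc (x : 'I_n -> X) (cb : book (Bi * Si)%type n) := covered qd comp xr cand ec x K cb.
pose enc (cb : book (Bi * Si)%type n) (x : {ffun 'I_n -> X}) : option {ffun 'I_K -> Bi * Si} :=
  match excluded_middle_informative (isc x cb) with
  | left h => Some (proj1_sig (constructive_indefinite_description _ h))
  | right _ => None
  end.
have [u0 _] : exists u : Uv m c, True.
  apply: Classical_Prop.NNPP => no; have := qd_sum; rewrite big1; first lra.
  by move=> w _; case: no; exists w.1.1.
(* [covered] speaks of option vectors; this inverse of [UA] at the full set turns them back into
   values of U, with [u0] as default. *)
pose decode (o : {ffun 'I_K -> option nat}) := odflt u0 [pick u : Uv m c | UA m c setT u == o].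
have decodeK u : decode (UA m c setT u) = u.
  rewrite /decode; case: pickP => [u' /eqP/asm_inj_UA //|/(_ u)]; by rewrite eqxx.
have UlK : Ul K = [set: 'I_K] by apply/setP => i; rewrite !inE ltn_ord.
have encP cb x a : enc cb x = Some a -> (forall j, cand j (a j)) /\
     typ ec (fun w => w.1) (fun k => (asm (sel cb a k), x k)).
  rewrite /enc; case: excluded_middle_informative => // h [<-].
  case: constructive_indefinite_description => {}a /= [va ta]; split => //.
  apply: (typ_map (h := fun s : X * {ffun 'I_K ->
    option nat} => (decode s.2, s.1))) ta => [[[u x'] y]|k].
    by rewrite /st UlK /= -[cU comp setT _]/(UA m c setT u) decodeK.
  by rewrite UlK /= cA_asm decodeK.
(* The four failures: an atypical source word, no covering tuple, side information not typical with
   the chosen words, and possible confusion at some decoder. Each gets [eta / 4]. *)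
pose i1 (w : source n) := ~ typ (2 * e0) xr (xs w).
pose i2 (cb : book (Bi * Si)%type n) (w : source n) := typ (2 * e0) xr (xs w) /\ ~ isc (xs w) cb.
pose i3 (cb : book (Bi * Si)%type n) (w : source n) := exists a, enc cb [ffun k =>
  (w k).1] = Some a /\
  ~ typ ef (fun w => w) (fun k => ((asm (sel cb a k), (w k).1), (w k).2)).
pose i4 (cb : book (Bi * Si)%type n) (w : source n) (lA : 'I_m * {set 'I_K}) :=
  (lA.2 \subset Dl m v lA.1 /\ lA.2 != set0) /\
  confusable qd comp xr (yr lA.1) lA.2 (Dl m v lA.1) ef cb1 cs (xs w) (fun k => (w k).2 lA.1) cb.
have bk0 := bookp_ge0 qd_ge0 (I := ('I_K * (Bi * Si))%type) (n := n).
have bk1 := bookp_sum qd_sum ('I_K * (Bi * Si))%type n.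
suff avg : \sum_(cb : book (Bi * Si)%type n) bookp qd cb *
    (\sum_(w : source n) srcp w * ind (~ good cb1 cs ef cb (enc cb) w)) <= eta.
  have [cb hcb] := average_le bk0 bk1 avg.
  exists Bi, Si, cb1, cs, ef, cb, (enc cb); split; last first.
    by split => //; rewrite efE; lra.
  move=> j; rewrite cN; have [s1 [_ [_ [s2 _]]]] := sizes j; split => //.
  apply: Rle_trans s2 _; apply: Rmult_le_compat_l; first lra.
  apply: exp_le; apply: Rmult_le_compat_l; first exact: pos_INR.
  by nra.
apply: (@Rle_trans _ (\sum_(cb : book (Bi * Si)%type n) bookp qd cb *
    (\sum_(w : source n) srcp w * (ind (i1 w) + ind (i2 cb w) + ind (i3 cb w) +
        \sum_(lA : 'I_m * {set 'I_K}) ind (i4 cb w lA))))).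
  apply: sum_le => cb _; apply: Rmult_le_compat_l; first exact: bk0.
  apply: sum_le => w _; apply: Rmult_le_compat_l; first exact: srcp_ge0.
  apply: (@Rle_trans _ (ind (((i1 w \/ i2 cb w) \/ i3 cb w) \/ exists lA, i4 cb w lA))).
    apply: ind_le => ng; apply: Classical_Prop.NNPP.
    move=> /Classical_Prop.not_or_and[/Classical_Prop.not_or_and[/Classical_Prop.not_or_and[n1' n2]
      n3] n4].
    apply: ng; split; last first.
      by move=> l A Al A0 cf; apply: n4; exists (l, A).
    have tx : typ (2 * e0) xr (xs w) by apply: Classical_Prop.NNPP.
    have cx : isc [ffun k => (w k).1] cb.
      have : isc (xs w) cb by apply: Classical_Prop.NNPP => nc; apply: n2.
      move=> [a [va ta]]; exists a; split => //; apply: (typ_map (h := fun t => t)) ta => // k.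
      by rewrite ffunE.
    have [a ea] : exists a, enc cb [ffun k => (w k).1] = Some a.
      by rewrite /enc; case: excluded_middle_informative => // h; eexists.
    exists a; split => //; split.
      by move=> j; have [va _] := encP _ _ _ ea; have /andP[] := va j.
    by apply: Classical_Prop.NNPP => nt; apply: n3; exists a.
  apply: Rle_trans (ind_or _ _) _; apply: Rplus_le_compat; last exact: ind_exists.
  apply: Rle_trans (ind_or _ _) _; apply: Rplus_le_compat; last lra.
  exact: ind_or.
have -> : \sum_(cb : book (Bi * Si)%type n) bookp qd cb *
    (\sum_(w : source n) srcp w * (ind (i1 w) + ind (i2 cb w) + ind (i3 cb w) +
        \sum_(lA : 'I_m * {set 'I_K}) ind (i4 cb w lA))) =
   \sum_(cb : book (Bi * Si)%type n) bookp qd cb * (\sum_(w : source n) srcp w * ind (i1 w)) +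
   \sum_(cb : book (Bi * Si)%type n) bookp qd cb * (\sum_(w : source n) srcp w * ind (i2 cb w)) +
   \sum_(cb : book (Bi * Si)%type n) bookp qd cb * (\sum_(w : source n) srcp w * ind (i3 cb w)) +
   \sum_(cb : book (Bi * Si)%type n) bookp qd cb * (\sum_(w : source n) srcp w *
        \sum_(lA : 'I_m * {set 'I_K}) ind (i4 cb w lA)).
  rewrite -!big_split /=; apply: eq_bigr => cb _; rewrite -!Rmult_plus_distr_l -!big_split /=.
  by congr (_ * _); apply: eq_bigr => w _; rewrite -!Rmult_plus_distr_l.
suff [b1 [b2 [b3 b4]]] :
   \sum_(cb : book (Bi * Si)%type n) bookp qd cb * (\sum_(w : source n) srcp w *
     ind (i1 w)) <= eta / 4 /\
   \sum_(cb : book (Bi * Si)%type n) bookp qd cb * (\sum_(w : source n) srcp w *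
     ind (i2 cb w)) <= eta / 4 /\
   \sum_(cb : book (Bi * Si)%type n) bookp qd cb * (\sum_(w : source n) srcp w *
     ind (i3 cb w)) <= eta / 4 /\
   \sum_(cb : book (Bi * Si)%type n) bookp qd cb * (\sum_(w : source n) srcp w *
        \sum_(lA : 'I_m * {set 'I_K}) ind (i4 cb w lA)) <= eta / 4 by lra.
split; [|split; [|split]].
- apply: (double_expectation_le_l (F := fun _ w => ind (i1 w)) bk0 bk1) => _.
  exact: Rle_trans (HCa n n1) ha.
- apply: (double_expectation_le_r (F := fun cb w => ind (i2 cb w)) bk0 bk1) => w.
  have [tx|ntx] := excluded_middle_informative (typ (2 * e0) xr (xs w)); last first.
    rewrite big1; first lra.
    by move=> cb _; rewrite ind0 ?Rmult_0_r // => -[].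
  apply: Rle_trans (hc _ cand (xs w) _ tx).
    apply: sum_le => cb _; apply: Rmult_le_compat_l; first exact: bk0.
    by apply: ind_le => -[].
  by move=> j; rewrite ccand; have [_ [_ [[]]]] := sizes j.
- apply: (double_expectation_le_l (F := fun cb w => ind (i3 cb w)) bk0 bk1) => cb.
  (* With the codebook fixed the encoder's choice depends on the source word alone, so given that
     word the side information is still a fresh channel output. *)
  rewrite (channel_sum (fun w => ind (i3 cb w))).
  apply: (@Rle_trans _ (\sum_(x : {ffun 'I_n -> X}) \prod_(k : 'I_n) PX (x k) * (eta / 4)));
    last first.
    by rewrite -mul_suml PX_sum; lra.
  apply: sum_le => x _; apply: Rmult_le_compat_l; first by apply: prod_ge0 => k _; apply: PX_ge0.
  have xE y : [ffun k => ([ffun k => (x k, y k)] k : X * Yv m Y).1] = x by apply/ffunP => k;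
    rewrite !ffunE.
  case ex : (enc cb x) => [a|]; last first.
    rewrite big1; first lra.
    by move=> y _; rewrite ind0 ?Rmult_0_r // => -[a []]; rewrite xE ex.
  have [_ ta] := encP _ _ _ ex.
  apply: Rle_trans hb; apply: Rle_trans (HCb n _ n1 ta).
  apply: sum_le => y _; apply: Rmult_le_compat_l; first by apply: prod_ge0 => k _; apply: chan_ge0.
  apply: ind_le => -[a' []]; rewrite xE ex => -[<-] nt ty; apply: nt.
  by apply: (typ_map (h := fun t => t)) ty => // k; rewrite !ffunE.
- apply: (double_expectation_le_r (F := fun cb w =>
  \sum_(lA : 'I_m * {set 'I_K}) ind (i4 cb w lA)) bk0 bk1) => w.
  rewrite (eq_bigr (fun cb => \sum_(lA : 'I_m * {set 'I_K}) bookp qd cb * ind (i4 cb w lA))) =>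
    [|cb _]; last by rewrite mul_sumr.
  rewrite exchange_big /=.
  apply: (@Rle_trans _ (\sum_(lA : 'I_m * {set 'I_K}) eta / 4 / (Np + 1))); last first.
    rewrite sum_constT -/Np; apply: (Rmult_le_reg_r (Np + 1)); first lra.
    have -> : Np * (eta / 4 / (Np + 1)) * (Np + 1) = Np * (eta / 4) by field; lra.
    nra.
  apply: sum_le => lA _.
  have [[sA nA]|no] := excluded_middle_informative (lA.2 \subset Dl m v lA.1 /\ lA.2 != set0);
    last first.
    rewrite big1; first by apply: Rlt_le; apply: Rdiv_lt_0_compat; lra.
    by move=> cb _; rewrite ind0 ?Rmult_0_r // => -[].
  apply: (@Rle_trans _ (3 ^ K * exp (- (INR n * (Delta / 2))))); last first.
    have p3 : 0 < 3 ^ K by apply: pow_lt; lra.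
    apply: Rle_trans (Rmult_le_compat_l _ _ _ (Rlt_le _ _ p3) hd) _.
    by right; field; split; lra.
  apply: (@Rle_trans _ (\sum_(cb : book (Bi * Si)%type n) bookp qd cb *
      ind (confusable qd comp xr (yr lA.1) lA.2 (Dl m v lA.1) ef cb1 cs (xs w) (fun k =>
        (w k).2 lA.1) cb))).
    apply: sum_le => cb _; apply: Rmult_le_compat_l; first exact: bk0.
    by apply: ind_le => -[].
  apply: Rle_trans (packing qd_ge0 qd_sum comp xr (yr lA.1) ef cb1 cs (xs w) (fun k =>
    (w k).2 lA.1) sA) _.
  have hp := Hpack lA; rewrite /C1 /C2 in hp.
  apply: (pack_bound (Iv := Ij) (Rp := Rp) (delta := delta) nA _ (Rp_pack sA nA)) => //.
  + by rewrite chain_rule.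
  + by move=> j; rewrite cN cB; have [_ [_ [[]]]] := sizes j => *; split => //;
    apply: Rmult_le_pos; apply: pos_INR.
  + by move=> j; rewrite cB; have [_ [_ [_ []]]] := sizes j.
Qed.

(** On good blocks all decoders recover the encoder's words and typicality costs at most [eps * dm];
    the other blocks have probability at most [eta] and cost at most [dm]. *)
Lemma code_of_good (Xh : 'I_m -> finType) (d : forall l : 'I_m, X -> Xh l -> R) (D : 'I_m ->
  R) (dm : R)
    (n : nat) (Bi Si : finType) (cb1 : 'I_K -> pred Bi) (cs : 'I_K -> pred Si) (eps eta : R)
    (cb : book (Bi * Si)%type n) (e : {ffun 'I_n -> X} -> option {ffun 'I_K -> Bi * Si}) :
  (0 < n)%nat -> (forall l x xh, 0 <= d l x xh <= dm) -> 0 <= dm ->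
  (forall l : 'I_m, exists g : Uv m c -> Y l -> Xh l,
     (forall (u u' : Uv m c) (y : Y l), (forall j, j \in Dl m v l -> u j = u' j) ->
       g u y = g u' y) /\
     \sum_(w : Omega) qd w * d l w.1.2 (g w.1.1 (w.2 l)) <= D l) ->
  (forall j, (0 < #|cb1 j|)%nat) -> 0 <= eps ->
  \sum_(w : source n) srcp w * ind (~ good cb1 cs eps cb e w) <= eta ->
  exists M : nat, INR M = \prod_(j : 'I_K) INR #|cb1 j| /\
    is_code X m Y Xh P d n M (fun l => D l + (eps + eta) * dm).
Proof.
move=> n0 hdm dm0 hg hcb1 eps0 hgood.
have nR : 0 < INR n by apply: lt_0_INR; apply/ltP.
pose Msg := {b : {ffun 'I_K -> Bi} | [forall j, cb1 j (b j)]}.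
have [b0f hb0] : exists b : 'I_K -> Bi, forall j, cb1 j (b j).
  by apply: (fun_choice (R := fun j b => is_true (cb1 j b))) => j; have /card_gt0P[b hb] := hcb1 j;
    exists b.
have b0P : [forall j, cb1 j ([ffun j => b0f j] j)] by apply/forallP => j; rewrite ffunE.
pose b0 : Msg := exist _ [ffun j => b0f j] b0P.
exists #|{: Msg}|; split.
  rewrite card_sig -(sum_ind (fun b : {ffun 'I_K -> Bi} => [forall j, cb1 j (b j)])).
  rewrite (eq_bigr (fun b : {ffun 'I_K -> Bi} => \prod_(j : 'I_K) ind (cb1 j (b j)))).
    by rewrite (sum_prod (fun j b => ind (cb1 j b))); apply: eq_bigr => j _; rewrite sum_ind.
  move=> b _; rewrite -ind_forall; apply: Rle_antisym; apply: ind_le; first by move/forallP.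
  by move=> h; apply/forallP.
have [u0 _] : exists u : Uv m c, True.
  apply: Classical_Prop.NNPP => no; have := qd_sum; rewrite big1; first lra.
  by move=> w _; case: no; exists w.1.1.
pose f (x : {ffun 'I_n -> X}) : 'I_#|{: Msg}| :=
  enum_rank (if e x is Some a then insubd b0 [ffun j => (a j).1] else b0).
(* Decoder [l] tests only the words of subsets containing [l]; the other positions in [s] are
   arbitrary. *)
pose dect l (b : {ffun 'I_K -> Bi}) (y : {ffun 'I_n -> Y l}) (s : {ffun 'I_K -> Si}) :=
  (forall j, j \in Dl m v l -> cs j (s j)) /\
  typ eps (fun w => (cU comp (Dl m v l) w, yr l w))
    (fun k => (cA comp (Dl m v l) (sel cb [ffun j => (b j, s j)] k), y k)).
have [dec hdec] : exists dec : forall l, {ffun 'I_K -> Bi} -> {ffun 'I_n -> Y l} -> {ffun 'I_n ->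
  Uv m c},
    forall l b y, (exists s, dect l b y s) ->
      exists2 s, dect l b y s & forall k, dec l b y k = asm (sel cb [ffun j => (b j, s j)] k).
  pose dec l b y : {ffun 'I_n -> Uv m c} :=
    match excluded_middle_informative (exists s, dect l b y s) with
    | left h => [ffun k => asm (sel cb [ffun j =>
      (b j, proj1_sig (constructive_indefinite_description _ h) j)] k)]
    | right _ => [ffun k => u0]
    end.
  exists dec => l b y h; rewrite /dec; case: excluded_middle_informative => // h'.
  exists (proj1_sig (constructive_indefinite_description _ h')); last by move=> k; rewrite ffunE.
  exact: (proj2_sig (constructive_indefinite_description _ h')).
pose g l := proj1_sig (constructive_indefinite_description _ (hg l)).
have gP l := proj2_sig (constructive_indefinite_description _ (hg l)).
exists f, (fun l i y => [ffun k => g l (dec l (val (enum_val i)) y k) (y k)]) => l.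
have [gdep gD] := gP l; rewrite -/(g l) in gdep gD.
set Ed := \sum_(w : Omega) _ in gD.
have Ed_dm : Ed <= dm.
  apply: (@Rle_trans _ (\sum_(w : Omega) qd w * dm)); last by rewrite -mul_suml qd_sum; lra.
  by apply: sum_le => w _; apply: Rmult_le_compat_l;
    [exact: qd_ge0|case: (hdm l w.1.2 (g l w.1.1 (w.2 l)))].
suff pt (w : source n) : / INR n * (\sum_(k : 'I_n) d l (w k).1
      ([ffun k => g l (dec l (val (enum_val (f [ffun k' => (w k').1]))) [ffun k' =>
        (w k').2 l] k) ([ffun k' => (w k').2 l] k)] k))
    <= (D l + eps * dm) + dm * ind (~ good cb1 cs eps cb e w).
  apply: (@Rle_trans _ (\sum_(w : source n) srcp w * ((D l + eps * dm) + dm *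
    ind (~ good cb1 cs eps cb e w)))).
    by apply: sum_le => w _; apply: Rmult_le_compat_l; [exact: srcp_ge0|exact: pt].
  rewrite (eq_bigr (fun w =>
    srcp w * (D l + eps * dm) + dm * (srcp w * ind (~ good cb1 cs eps cb e w)))) => [|w _];
      last lra.
  rewrite big_split /= -mul_suml srcp_sum -mul_sumr.
  have := Rmult_le_compat_l dm _ _ dm0 hgood; set sg := \sum_(w : source n) _; lra.
apply: (Rmult_le_reg_l (INR n)) => //; rewrite -Rmult_assoc Rinv_r ?Rmult_1_l; last lra.
have Ed0 : 0 <= Ed.
  by apply: sum_ge0 => w' _; apply: Rmult_le_pos;
    [exact: qd_ge0|case: (hdm l w'.1.2 (g l w'.1.1 (w'.2 l)))].
have [[[a [ea [va ta]]] nc]|ng] := excluded_middle_informative (good cb1 cs eps cb e w); last first.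
  rewrite (ind1 ng) Rmult_1_r; apply: (@Rle_trans _ (INR n * dm)).
    by rewrite -sum_constn; apply: sum_le => k _;
      case: (hdm l (w k).1 ([ffun k => g l (dec l (val (enum_val (f [ffun k' =>
        (w k').1]))) [ffun k' => (w k').2 l] k) ([ffun k' => (w k').2 l] k)] k)).
  apply: Rmult_le_compat_l; first lra.
  by have := Rmult_le_pos _ _ eps0 dm0; lra.
set y := [ffun k' => (w k').2 l].
have -> : val (enum_val (f [ffun k' => (w k').1])) = [ffun j => (a j).1].
  rewrite /f ea enum_rankK val_insubd ifT //.
  by apply/forallP => j; rewrite ffunE; case: (va j).
have aE s : [ffun j => ([ffun j => (a j).1] j, s j)] = [ffun j => ((a j).1, s j)] :> {ffun 'I_K ->
  Bi * Si}.
  by apply/ffunP => j; rewrite !ffunE.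
have [s [hs ts] hk] : exists2 s, dect l [ffun j => (a j).1] y s &
    forall k, dec l [ffun j => (a j).1] y k = asm (sel cb [ffun j => ([ffun j =>
      (a j).1] j, s j)] k).
  apply: hdec; exists [ffun j => (a j).2]; split.
    by move=> j _; rewrite ffunE; case: (va j).
  apply: (typ_map (h := fun w : Omega => (UA m c (Dl m v l) w.1.1, w.2 l))) ta => // k.
  rewrite cA_asm /y ffunE /=; congr (UA _ _ _ (asm _), _).
  by congr sel; apply/ffunP => j; rewrite !ffunE; case: (a j).
(* A disagreement between decoder and encoder would make the set [A] of subsets where they differ
   nonempty, and the encoder's tuple would witness a confusion on it. *)
have sE j : j \in Dl m v l -> s j = (a j).2.
  move=> jD; apply: Classical_Prop.NNPP => sj.
  pose A := [set j in Dl m v l | s j != (a j).2].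
  have AD : A \subset Dl m v l by apply/subsetP => j'; rewrite inE => /andP[].
  have A0 : A != set0 by apply/set0Pn; exists j; rewrite inE jD; apply/eqP.
  (* Off [A], in particular at subsets the decoder does not read, the witness must repeat the
     encoder's index. *)
  apply: (nc l A AD A0); exists a, [ffun j => if j \in A then s j else (a j).2].
  split => //; split.
    move=> j'; rewrite ffunE; case jA: (j' \in A); last exact: eqxx.
    by move: jA; rewrite inE => /andP[j'D ->]; rewrite hs.
  split.
    apply: (typ_map (h := fun w : Omega => (UA m c setT w.1.1, w.1.2))) ta => // k.
    by rewrite cA_asm.
  apply: (typ_map (h := fun t => t)) ts => // k.
  rewrite /y ffunE; congr pair; apply/ffunP => j'; rewrite !ffunE; case: ifP => // j'D.
  rewrite /sel !ffunE; case: ifP => // /negbT; rewrite inE j'D /= negbK => /eqP ->.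
  by [].
(* Typicality tested on the distortion itself: its sum over the block is at most (1 + eps) n times
   its mean. *)
have := ta (fun w => d l w.1.2 (g l w.1.1 (w.2 l))) (fun w => proj1 (hdm _ _ _)).
rewrite -/(esp _ _) /esp -/Ed => /abs_bounds[_].
rewrite ind0; last by apply; split; [exists a|].
rewrite Rmult_0_r Rplus_0_r => hd; apply: (@Rle_trans _ (INR n * Ed + eps * (INR n * Ed))).
  apply: Rle_trans hd; right; apply: eq_bigr => k _; rewrite ffunE hk /= /y ffunE.
  congr (d l _ _); apply: gdep => j jD; rewrite !ffunE /sel !ffunE (sE j jD).
  by case: (a j).
have := Rmult_le_compat_l _ _ _ eps0 Ed_dm; have := Rmult_le_compat_l _ _ _ (Rlt_le _ _ nR) gD.
move=> h1 h2; have h3 := Rmult_le_compat_l _ _ _ (Rlt_le _ _ nR) h2; lra.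
Qed.

End Setting.

(** * Achievability and time sharing *)

Lemma ln_prod (I : Type) (r : seq I) (F : I -> R) :
  (forall i, 0 < F i) -> ln (\prod_(i <- r) F i) = \sum_(i <- r) ln (F i).
Proof.
move=> F0; elim: r => [|i r IH]; first by rewrite !big_nil ln_1.
rewrite !big_cons ln_mult ?IH //; exact: prod_gt0.
Qed.

Lemma exists_bound (I : finType) (F : I -> R) : exists2 b, 0 <= b & forall i, F i <= b.
Proof.
exists (\sum_(i : I) Rabs (F i)); first by apply: sum_ge0 => i _; apply: Rabs_pos.
move=> i; apply: Rle_trans (Rle_abs _) _.
exact: (sum_term_le i (F := fun i => Rabs (F i)) (fun j => Rabs_pos _)).
Qed.

Lemma distortion_bound (X : finType) (m : nat) (Xh : 'I_m -> finType)
    (d : forall l : 'I_m, X -> Xh l -> R) :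
  exists2 dm, 0 <= dm & forall l x xh, d l x xh <= dm.
Proof.
have h l : exists b, 0 <= b /\ forall x xh, d l x xh <= b.
  have [b b0 hb] := exists_bound (fun p : X * Xh l => d l p.1 p.2).
  by exists b; split => // x xh; apply: (hb (x, xh)).
have [b hb] := fun_choice h; have [dm dm0 hdm] := exists_bound b.
by exists dm => // l x xh; have [_ h'] := hb l; apply: Rle_trans (h' x xh) (hdm l).
Qed.

Section Achievability.
Context (X : finType) (m : nat) (Y Xh : 'I_m -> finType).
Context (P : X -> Yv m Y -> R) (d : forall l : 'I_m, X -> Xh l -> R).
Context (P0 : forall x y, 0 <= P x y) (P1 : \sum_(x : X) \sum_(y : Yv m Y) P x y = 1).
Arguments d : clear implicits.
Context (d0 : forall l x xh, 0 <= d l x xh).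

Lemma Rprime_achievable (D : 'I_m -> R) (b : R) :
  Rprime_val X m Y Xh P d D b -> achievable X m Y Xh P d D b.
Proof.
move=> [v [_ [_ [c [p [Rr [Rp [[p0 [pP [markov hg]]] [[R0 [Rcov Rpack]] ->]]]]]]]]] eps eps0.
pose q := qd p; pose I := Ij q (@comp X m Y c) (@xr X m Y c).
have q0 := qd_ge0 p0; have q1 := qd_sum P1 pP.
(* A bin cannot usefully exceed its codebook. Truncation keeps the packing constraints, and the
   remaining rate max(I - R', 0) is still bounded by [Rr j]. *)
pose Rq j := Rmin (Rp j) (I j).
have Rq_range j : 0 <= Rq j <= I j.
  split; last exact: Rmin_r.
  by apply: Rmin_glb; [case: (R0 j)|apply: minfo_ge0].
have compE j : entropy q (fun w => w.1.1 j) = entropy q (comp j).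
  by apply: entropy_recode => w w'; rewrite /comp -val_eqE.
have IE j : minfo q (fun w => (w.1.2, UA m c (Uminus m j) w.1.1)) (fun w => w.1.1 j) = I j.
  rewrite /minfo /I /Ij /minfo compE; congr (_ - _).
  by apply: entropy_recode => w w'; rewrite !xpair_eqE /comp -val_eqE.
have Rq_le j : I j - Rq j <= Rr j.
  have [r0 _] := R0 j; have := Rcov j; rewrite -/q IE /Rq => h.
  by rewrite /Rmin; case: Rle_dec; lra.
have Rq_pack (l : 'I_m) (A : {set 'I_(K m)}) : A \subset Dl m v l -> A != set0 ->
    \sum_(j in A) Rq j <= \sum_(j in A) entropy q (comp j) +
      entropy q (fun w => (cU (@comp X m Y c) (Dl m v l :\: A) w, yr l w)) -
      entropy q (fun w => (cU (@comp X m Y c) A w, (cU (@comp X m Y c) (Dl m v l :\: A) w,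
        yr l w))).
  move=> AD A0; apply: (@Rle_trans _ (\sum_(j in A) Rp j)).
    by apply: sum_le => j _; apply: Rmin_l.
  apply: Rle_trans (Rpack l A AD A0) _; rewrite -/q /centropy.
  rewrite (eq_bigr (fun j => entropy q (comp j))) => [|j _]; last exact: compE.
  right; rewrite /Rminus Ropp_plus_distr Ropp_involutive.
  rewrite Rplus_assoc; congr (_ + _); exact: Rplus_comm.
have [dm dm0 hdm] := distortion_bound d.
have Km0 := pos_INR (K m).
(* [tol] bounds both the typicality tolerance and the error probability, which cost [2 * tol * dm]
   in distortion. In rate, the slack [2 * Delta] of all codebooks takes half of [eps]; the factors 2
   in the numbers of bins take the other half for large n. *)
pose tol := eps / (2 * (dm + 1)); pose Delta := eps / (4 * (INR (K m) + 1)).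
have tol0 : 0 < tol by apply: Rdiv_lt_0_compat; lra.
have Delta0 : 0 < Delta by apply: Rdiv_lt_0_compat; lra.
have eps2 : 0 < eps / 2 by lra.
have [N HN] := ev_and (random_coding P0 P1 p0 pP markov Rq_range Rq_pack Delta0 tol0 tol0)
  (ev_div (INR (K m) * ln 2) eps2).
exists N => n Nn n1; have [[Bi [Si [cb1 [cs [ef [cb [e [hN [hef hgood]]]]]]]]] hK] := HN n Nn n1.
have hd l x xh : 0 <= d l x xh <= dm by split.
have hg' (l : 'I_m) : exists g : Uv m c -> Y l -> Xh l,
   (forall (u u' : Uv m c) (y : Y l), (forall j, j \in Dl m v l -> u j = u' j) -> g u y = g u' y) /\
   \sum_(w : Omega X Y c) qd p w * d l w.1.2 (g w.1.1 (w.2 l)) <= D l.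
  have [g [g1 g2]] := hg l; exists g; split => //.
  by rewrite (sum_Omega p (fun w => d l w.1.2 (g w.1.1 (w.2 l)))).
have [M [ME [f [g hfg]]]] := code_of_good P0 P1 p0 pP n1 hd dm0 hg' (fun j => (hN j).1) hef.1 hgood.
have nR : 0 < INR n by apply: lt_0_INR; apply/ltP.
exists M; split.
  exists f, g => l; apply: Rle_trans (hfg l) _; apply: Rplus_le_compat_l.
  apply: (@Rle_trans _ ((tol + tol) * dm)); first by apply: Rmult_le_compat_r => //; lra.
  have -> : eps = (tol + tol) * (dm + 1) by rewrite /tol; field; lra.
  by apply: Rmult_le_compat_l; lra.
have c0 j : 0 < INR #|cb1 j| by apply: lt_0_INR; apply/ltP; case: (hN j).
rewrite ME ln_prod //.
apply: (@Rle_trans _ ((\sum_(j : 'I_(K m)) (ln 2 + INR n * (Rr j + 2 * Delta))) / INR n)).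
  apply: Rmult_le_compat_r; first by left; apply: Rinv_0_lt_compat.
  apply: sum_le => j _; have [_ h] := hN j.
  apply: Rle_trans (ln_le (c0 j) h) _.
  rewrite ln_mult ?ln_exp; [|lra|exact: exp_pos].
  apply: Rplus_le_compat_l; apply: Rmult_le_compat_l; first lra.
  by apply: Rplus_le_compat_r; exact: Rq_le.
rewrite big_split /= sum_constn -mul_sumr big_split /= sum_constn.
have -> : (INR (K m) * ln 2 + INR n * (\sum_(j : 'I_(K m)) Rr j + INR (K m) * (2 *
  Delta))) / INR n =
  INR (K m) * ln 2 / INR n + \sum_(j : 'I_(K m)) Rr j + INR (K m) * (2 * Delta) by field; lra.
have : INR (K m) * (2 * Delta) <= eps / 2.
  have -> : eps / 2 = (INR (K m) + 1) * (2 * Delta) by rewrite /Delta; field; lra.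
  by apply: Rmult_le_compat_r; lra.
set s := \sum_(j : 'I_(K m)) Rr j; lra.
Qed.

(* Distortions are not divided by the block length here, so that they add up
   under concatenation; length 0 is allowed. *)
Definition total_code (n M : nat) (T : 'I_m -> R) : Prop :=
  exists Msg : finType, #|Msg| = M /\
  exists (f : {ffun 'I_n -> X} -> Msg)
         (g : forall l : 'I_m, Msg -> {ffun 'I_n -> Y l} -> {ffun 'I_n -> Xh l}),
    forall l, \sum_(w : {ffun 'I_n -> X * Yv m Y}) srcp P w *
      (\sum_(k : 'I_n) d l (w k).1 (g l (f [ffun k' => (w k').1]) [ffun k' =>
        (w k').2 l] k)) <= T l.

Lemma total_codeE n M (Dv : 'I_m -> R) : (0 < n)%nat ->
  is_code X m Y Xh P d n M Dv <-> total_code n M (fun l => INR n * Dv l).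
Proof.
move=> n0; have nR : 0 < INR n by apply: lt_0_INR; apply/ltP.
have E M' (f : {ffun 'I_n -> X} -> 'I_M') g l : INR n * exp_dist X m Y Xh P d n M' f g l =
   \sum_(w : {ffun 'I_n -> X * Yv m Y}) srcp P w *
      (\sum_(k : 'I_n) d l (w k).1 (g l (f [ffun k' => (w k').1]) [ffun k' => (w k').2 l] k)).
  rewrite /exp_dist mul_sumr; apply: eq_bigr => w _.
  rewrite -/(srcp P w) -Rmult_assoc (Rmult_comm (INR n)) Rmult_assoc; congr (_ * _).
  by rewrite -Rmult_assoc Rinv_r ?Rmult_1_l //; lra.
split.
  move=> [f [g h]]; exists 'I_M; rewrite card_ord; split => //; exists f, g => l.
  apply: Rle_trans (Req_le _ _ (esym (E M f g l))) _.
  by apply: Rmult_le_compat_l; [lra|exact: h].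
move=> [Msg [<- [f [g h]]]].
exists (fun x => enum_rank (f x)), (fun l i => g l (enum_val i)) => l.
apply: (Rmult_le_reg_l (INR n)) => //; rewrite E; apply: Rle_trans (h l).
by right; apply: eq_bigr => w _; rewrite enum_rankK.
Qed.

Lemma total_code_gt0 n M T : total_code n M T -> (0 < M)%nat.
Proof.
move=> [Msg [<- [f _]]].
have [x _] : exists x : {ffun 'I_n -> X}, True.
  apply: Classical_Prop.NNPP => no; have := P1; rewrite big1; first lra.
  by move=> x _; case: no; exists [ffun => x].
by apply/card_gt0P; exists (f x).
Qed.

Lemma total_code_le n M (T T' : 'I_m -> R) :
  (forall l, T l <= T' l) -> total_code n M T -> total_code n M T'.
Proof.
move=> h [Msg [EM [f [g hf]]]]; exists Msg; split => //; exists f, g => l.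
exact: Rle_trans (hf l) (h l).
Qed.

(** Fills the letters left over when a block is cut into pieces of integer length, at no rate. *)
Lemma total_code_const n dm : (forall l x xh, d l x xh <= dm) -> (forall l, Xh l) ->
  total_code n 1 (fun l => INR n * dm).
Proof.
move=> hdm xh0; exists unit; rewrite card_unit; split => //.
exists (fun _ => tt), (fun l _ _ => [ffun => xh0 l]) => l.
apply: (@Rle_trans _ (\sum_(w : {ffun 'I_n -> X * Yv m Y}) srcp P w * (INR n * dm))).
  apply: sum_le => w _; apply: Rmult_le_compat_l; first exact: srcp_ge0.
  by rewrite -sum_constn; apply: sum_le.
by rewrite -mul_suml srcp_sum //; lra.
Qed.

Lemma total_code0 : total_code 0 1 (fun _ => 0).
Proof.
exists unit; rewrite card_unit; split => //.
exists (fun _ => tt), (fun l _ _ => [ffun k : 'I_0 => match notF (ltn_ord k) with end]) => l.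
by rewrite big1; [lra|move=> w _; rewrite big_ord0 Rmult_0_r].
Qed.

Definition join (A : Type) n1 n2 (w1 : {ffun 'I_n1 -> A}) (w2 : {ffun 'I_n2 -> A}) :
  {ffun 'I_(n1 + n2)%nat -> A} :=
  [ffun k => match fintype.split k with inl i => w1 i | inr i => w2 i end].

Lemma joinl (A : Type) n1 n2 (w1 : {ffun 'I_n1 -> A}) (w2 : {ffun 'I_n2 -> A}) i :
  join w1 w2 (lshift n2 i) = w1 i.
Proof. by rewrite ffunE (unsplitK (inl i)). Qed.

Lemma joinr (A : Type) n1 n2 (w1 : {ffun 'I_n1 -> A}) (w2 : {ffun 'I_n2 -> A}) i :
  join w1 w2 (rshift n1 i) = w2 i.
Proof. by rewrite ffunE (unsplitK (inr i)). Qed.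

Lemma sum_join (A : finType) n1 n2 (F : {ffun 'I_(n1 + n2)%nat -> A} -> R) :
  \sum_(w : {ffun 'I_(n1 + n2)%nat -> A}) F w =
  \sum_(w1 : {ffun 'I_n1 -> A}) \sum_(w2 : {ffun 'I_n2 -> A}) F (join w1 w2).
Proof.
rewrite pair_big /= (reindex (fun p : {ffun 'I_n1 -> A} * {ffun 'I_n2 -> A} => join p.1 p.2)) //=.
exists (fun w : {ffun 'I_(n1 + n2)%nat -> A} =>
  ([ffun i => w (lshift n2 i)], [ffun i => w (rshift n1 i)])).
  by move=> [w1 w2] _ /=; congr pair; apply/ffunP => i; rewrite ffunE ?joinl ?joinr.
move=> w _; apply/ffunP => k; rewrite ffunE /=.
by case E: (fintype.split k) => [i|i]; rewrite ffunE -(splitK k) E.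
Qed.

Lemma total_code_cat n1 n2 M1 M2 T1 T2 :
  total_code n1 M1 T1 -> total_code n2 M2 T2 ->
  total_code (n1 + n2) (M1 * M2) (fun l => T1 l + T2 l).
Proof.
move=> [Msg1 [E1 [f1 [g1 h1]]]] [Msg2 [E2 [f2 [g2 h2]]]].
exists (Msg1 * Msg2)%type; rewrite card_prod E1 E2; split => //.
pose lp (A : finType) (w : {ffun 'I_(n1 + n2)%nat -> A}) := [ffun i : 'I_n1 => w (lshift n2 i)].
pose rp (A : finType) (w : {ffun 'I_(n1 + n2)%nat -> A}) := [ffun i : 'I_n2 => w (rshift n1 i)].
exists (fun x => (f1 (lp X x), f2 (rp X x))),
  (fun l b y => join (g1 l b.1 (lp (Y l) y)) (g2 l b.2 (rp (Y l) y))) => l.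
pose d1 w1 := \sum_(k : 'I_n1) d l (w1 k).1 (g1 l (f1 [ffun k' => (w1 k').1]) [ffun k' =>
  (w1 k' : X * Yv m Y).2 l] k).
pose d2 w2 := \sum_(k : 'I_n2) d l (w2 k).1 (g2 l (f2 [ffun k' => (w2 k').1]) [ffun k' =>
  (w2 k' : X * Yv m Y).2 l] k).
apply: Rle_trans (Rplus_le_compat _ _ _ _ (h1 l) (h2 l)); right.
rewrite sum_join.
transitivity (\sum_(w1 : {ffun 'I_n1 -> X * Yv m Y}) \sum_(w2 : {ffun 'I_n2 -> X * Yv m Y})
    (srcp P w1 * d1 w1 * srcp P w2 + srcp P w1 * (srcp P w2 * d2 w2))).
  apply: eq_bigr => w1 _; apply: eq_bigr => w2 _.
  have -> : srcp P (join w1 w2) = srcp P w1 * srcp P w2.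
    rewrite /srcp big_split_ord /=; congr (_ * _); apply: eq_bigr => i _.
      by rewrite joinl.
    by rewrite joinr.
  rewrite big_split_ord /=.
  set s1 := \sum_(i : 'I_n1) _; set s2 := \sum_(i : 'I_n2) _.
  have -> : s1 = d1 w1.
    apply: eq_bigr => i _; rewrite !joinl; congr (d l _ (g1 l (f1 _) _ i)).
      by apply/ffunP => k; rewrite !ffunE -[fintype.split _]/(fintype.split (lshift n2 k))
        (unsplitK (inl k)).
    by apply/ffunP => k; rewrite !ffunE -[fintype.split _]/(fintype.split (lshift n2 k)) (unsplitK
      (inl k)).
  have -> : s2 = d2 w2.
    apply: eq_bigr => i _; rewrite !joinr; congr (d l _ (g2 l (f2 _) _ i)).
      by apply/ffunP => k; rewrite !ffunE -[fintype.split _]/(fintype.split (rshift n1 k))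
        (unsplitK (inr k)).
    by apply/ffunP => k; rewrite !ffunE -[fintype.split _]/(fintype.split (rshift n1 k)) (unsplitK
      (inr k)).
  rewrite Rmult_plus_distr_l; congr (_ + _); last exact: Rmult_assoc.
  by rewrite !Rmult_assoc; congr (_ * _); exact: Rmult_comm.
rewrite (eq_bigr (fun w1 => srcp P w1 * d1 w1 + srcp P w1 * \sum_(w2 : {ffun 'I_n2 ->
  X * Yv m Y}) srcp P w2 * d2 w2)).
  by rewrite big_split /= -mul_suml srcp_sum // Rmult_1_l.
by move=> w1 _; rewrite big_split /= -mul_sumr srcp_sum // -mul_sumr Rmult_1_r.
Qed.

Lemma total_code_sum (I : Type) (r : seq I) (n M : I -> nat) (T : I -> 'I_m -> R) :
  (forall i, total_code (n i) (M i) (T i)) ->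
  total_code (\big[addn/0%nat]_(i <- r) n i) (\big[muln/1%nat]_(i <- r) M i)
    (fun l => \sum_(i <- r) T i l).
Proof.
move=> h; elim: r => [|i r IH].
  by rewrite !big_nil; apply: total_code_le total_code0 => l; rewrite big_nil; lra.
rewrite !big_cons; apply: total_code_le (total_code_cat (h i) IH) => l; rewrite big_cons; lra.
Qed.

(** Time sharing: the block is cut into pieces of length the floor of lam_i n, and the at most [k]
    letters left over get a constant reconstruction. *)
Lemma achievable_convex (k : nat) (lam : 'I_k -> R) (Ds : 'I_k -> 'I_m -> R) (a : 'I_k -> R)
    (D : 'I_m -> R) : (forall l, Xh l) ->
  (forall i, 0 <= lam i) -> \sum_(i : 'I_k) lam i = 1 ->
  (forall l, \sum_(i : 'I_k) lam i * Ds i l = D l) ->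
  (forall i, achievable X m Y Xh P d (Ds i) (a i)) ->
  achievable X m Y Xh P d D (\sum_(i : 'I_k) lam i * a i).
Proof.
move=> xh0 lam0 lam1 DE ach eps eps0.
have [dm dm0 hdm] := distortion_bound d.
have eps2 : 0 < eps / 2 by lra.
have k0 := pos_INR k.
have ev_i i : ev (fun n => forall ni, INR ni <= lam i * INR n < INR ni.+1 ->
   exists M, total_code ni M (fun l => INR ni * (Ds i l + eps / 2)) /\
     ln (INR M) <= INR ni * (a i + eps / 2)).
  have [N HN] := ach i _ eps2.
  have [l0|ln0] := Rle_lt_dec (lam i) 0.
    (* A weight 0 gives an empty piece at every n, where achievability, which speaks of large
       lengths, says nothing. *)
    exists 0%nat => n _ _ ni [h _].
    have l00 : lam i = 0 by have := lam0 i; lra.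
    have ni0 : ni = 0%nat by apply: INR_eq; have := pos_INR ni; rewrite INR_0; rewrite l00 in h;
      lra.
    exists 1%nat; rewrite ni0 INR_1 ln_1 INR_0; split; last lra.
    by apply: total_code_le total_code0 => l; lra.
  apply: ev_imp (ev_ge ((INR N + 1) / lam i)) => n n1 h ni [h1 h2].
  have h3 : INR N + 1 <= lam i * INR n.
    have := Rmult_le_compat_l _ _ _ (Rlt_le _ _ ln0) h.
    by have -> : lam i * ((INR N + 1) / lam i) = INR N + 1 by field; lra.
  have Nni : (N < ni.+1)%nat by apply/ltP; apply: INR_lt; lra.
  have ni1 : (0 < ni)%nat.
    by apply/ltP; apply: INR_lt; rewrite S_INR in h2; have := pos_INR N; rewrite INR_0; lra.
  have niR : 0 < INR ni by apply: lt_0_INR; apply/ltP.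
  have [M [code rate]] := HN ni Nni ni1; exists M; split; first exact/total_codeE.
  have := Rmult_le_compat_l _ _ _ (Rlt_le _ _ niR) rate.
  by have -> : INR ni * (ln (INR M) / INR ni) = ln (INR M) by field; lra.
(* Rounding moves each length by less than one letter, costing at most the absolute value of its
   target, and each leftover letter costs at most [dm]; the total does not grow with n. *)
pose slack l := \sum_(i : 'I_k) Rabs (Ds i l) + INR k * dm.
have [N HN] := ev_and (ev_forall ev_i) (ev_and
  (ev_forall (fun l => ev_div (slack l) eps2)) (ev_div (\sum_(i : 'I_k) Rabs (a i)) eps2)).
exists N => n Nn n1; have [hi [hD ha]] := HN n Nn n1.
have nR : 0 < INR n by apply: lt_0_INR; apply/ltP.
have [ni hni] := fun_choice (fun i => nat_floor (Rmult_le_pos _ _ (lam0 i) (Rlt_le _ _ nR))).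
have [M hM] := fun_choice (fun i => hi i _ (hni i)).
have split_n (x : 'I_k -> R) : \sum_(i : 'I_k) INR (ni i) * x i <=
    INR n * (\sum_(i : 'I_k) lam i * x i) + \sum_(i : 'I_k) Rabs (x i).
  rewrite mul_sumr -big_split /=; apply: sum_le => i _.
  have [h1 h2] := hni i; rewrite S_INR in h2; have := Rle_abs (- x i); rewrite Rabs_Ropp => h3.
  have h4 := Rle_abs (x i); nra.
have INRs : INR (\big[addn/0%nat]_(i : 'I_k) ni i) = \sum_(i : 'I_k) INR (ni i).
  by apply: (big_morph INR) => [? ?|]; [exact: plus_INR|exact: INR_0].
have sn : \sum_(i : 'I_k) INR (ni i) <= INR n.
  rewrite -[X in _ <= X]Rmult_1_l -lam1 mul_suml; apply: sum_le => i _; by have [] := hni i.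
have sn' : INR n - INR k <= \sum_(i : 'I_k) INR (ni i).
  have -> : INR n - INR k = \sum_(i : 'I_k) (lam i * INR n - 1).
    by rewrite sumB sum_constn -mul_suml lam1; lra.
  by apply: sum_le => i _; have [_] := hni i; rewrite S_INR; lra.
have le_n : (\big[addn/0%nat]_(i : 'I_k) ni i <= n)%nat by apply/leP; apply: INR_le; rewrite INRs.
pose r := (n - \big[addn/0%nat]_(i : 'I_k) ni i)%nat.
have rR : INR r <= INR k.
  by rewrite /r minus_INR; [rewrite INRs; lra|apply/leP].
have tc := total_code_cat (total_code_sum (index_enum 'I_k) (fun i => (hM i).1))
   (total_code_const r hdm xh0).
rewrite /r subnKC // muln1 in tc.
have M0 i : 0 < INR (M i).
  by apply: lt_0_INR; apply/ltP; apply: (total_code_gt0 (hM i).1).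
exists (\big[muln/1%nat]_(i : 'I_k) M i); split.
  apply/total_codeE => //; apply: total_code_le tc => l.
  rewrite -/r (eq_bigr (fun i => INR (ni i) * Ds i l + INR (ni i) * (eps / 2))) => [|i _]; last lra.
  rewrite big_split /= -mul_suml.
  have h1 := split_n (fun i => Ds i l); rewrite DE in h1.
  have h2 := Rmult_le_compat_r dm _ _ dm0 rR.
  have h3 : (\sum_(i : 'I_k) INR (ni i)) * (eps / 2) <= INR n *
    (eps / 2) by apply: Rmult_le_compat_r; lra.
  have h4 := Rmult_le_compat_l _ _ _ (Rlt_le _ _ nR) (hD l).
  have h5 : INR n * (slack l / INR n) = slack l by field; lra.
  rewrite h5 /slack in h4; move: h1 h2 h3 h4.
  set x1 := \sum_(i : 'I_k) _ * Ds _ _; set x2 := \sum_(i : 'I_k) Rabs _;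
    set x3 := \sum_(i : 'I_k) INR _; lra.
apply: (Rmult_le_reg_l (INR n)) => //.
have -> : INR n * (ln (INR (\big[muln/1%nat]_(i : 'I_k) M i)) / INR n) =
   ln (INR (\big[muln/1%nat]_(i : 'I_k) M i)) by field; lra.
have -> : INR (\big[muln/1%nat]_(i : 'I_k) M i) = \prod_(i : 'I_k) INR (M i).
  by apply: (big_morph INR) => [? ?|]; [exact: mult_INR|exact: INR_1].
rewrite ln_prod //; apply: (@Rle_trans _ (\sum_(i : 'I_k) INR (ni i) * (a i + eps / 2))).
  by apply: sum_le => i _; have [_] := hM i.
rewrite (eq_bigr (fun i => INR (ni i) * a i + INR (ni i) * (eps / 2))) => [|i _]; last lra.
rewrite big_split /= -mul_suml.
have h1 := split_n a.
have h3 : (\sum_(i : 'I_k) INR (ni i)) * (eps / 2) <= INR n *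
  (eps / 2) by apply: Rmult_le_compat_r; lra.
have h4 := Rmult_le_compat_l _ _ _ (Rlt_le _ _ nR) ha.
have h5 : INR n * ((\sum_(i : 'I_k) Rabs (a i)) / INR n) = \sum_(i : 'I_k) Rabs (a i) by field; lra.
rewrite h5 in h4; move: h1 h3 h4.
set x1 := \sum_(i : 'I_k) _ * a _; set x2 := \sum_(i : 'I_k) Rabs _;
  set x3 := \sum_(i : 'I_k) INR _.
set x4 := \sum_(i : 'I_k) _ * a _; lra.
Qed.

(** The constant code needs a reconstruction letter; the estimator [g] of an admissible law supplies
    one, since the source has positive total mass. *)
Lemma Rprime_inhabited (D : 'I_m -> R) (b : R) l : Rprime_val X m Y Xh P d D b -> inhabited (Xh l).
Proof.
move=> [v [_ [_ [c [p [Rr [Rp [[p0 [pP [_ hg]]] _]]]]]]]].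
apply: Classical_Prop.NNPP => no; have := P1; rewrite big1; first lra.
move=> x _; apply: big1 => y _; rewrite -pP; apply: big1 => u _.
by have [g _] := hg l; case: no; exact: (inhabits (g u (y l))).
Qed.
End Achievability.

Unset Implicit Arguments.
Theorem theorem1 (X : finType) (m : nat) (Y Xh : 'I_m -> finType)
  (P : X -> {dffun forall l : 'I_m, Y l} -> R)
  (d : forall l : 'I_m, X -> Xh l -> R)
  (HP0 : forall x y, 0 <= P x y)
  (HP1 : \big[Rplus/0]_(x : X) \big[Rplus/0]_(y : {dffun forall l : 'I_m, Y l}) P x y = 1)
  (Hd : forall l x xh, 0 <= d l x xh)
  (D : 'I_m -> R) :
  forall b : R, Rach_val X m Y Xh P d D b -> RD_le X m Y Xh P d D b.
Proof.
move=> b [k [lam [Ds [a [lam0 [lam1 [DE [aR ->]]]]]]]] eps eps0.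
exists (\big[Rplus/0]_(i : 'I_k) (lam i * a i)); split; last lra.
have [i _] : exists i : 'I_k, True.
  apply: Classical_Prop.NNPP => no; move: lam1; rewrite big1; first lra.
  by move=> i _; case: no; exists i.
have xh0 l : Xh l.
  exact: (epsilon (Rprime_inhabited HP1 l (aR i)) (fun _ => True)).
apply: (achievable_convex HP0 HP1 xh0 lam0 lam1 DE) => i'.
exact: Rprime_achievable.
Qed.
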